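(* Let $S_n^2$ denote the $n$-dimensional split-star. Then for all $n\geqslant 4$, $\kappa_3(S_n^2)=4n-8$, $\kappa_4(S_n^2)=6n-14$, and $\kappa_5(S_n^2)=8n-20$.
   Context: For an integer $\ell\geqslant 2$, the $\ell$-component connectivity $\kappa_\ell(G)$ of a graph $G$ is the minimum number of vertices whose removal from $G$ results in a disconnected graph with at least $\ell$ components or a graph with fewer than $\ell$ vertices. For $n\geqslant 3$, permutations $p=p_1p_2\cdots p_n$ of $\{1,\dots,n\}$ are written as words; $\mathcal S_n$ is the set of all permutations. $p\,\mathrm{g}_{12}$ is obtained from $p$ by swapping the symbols at positions $1$ and $2$. For $3\leqslant i\leqslant n$, $p\,\mathrm{g}_i^+$ is obtained from $p$ by placing $p_i,p_1,p_2$ at positions $1,2,i$ respectively (other positions unchanged), and $p\,\mathrm{g}_i^-$ by placing $p_2,p_i,p_1$ at positions $1,2,i$ respectively. The split-star $S_n^2$ has vertex set $\mathcal S_n$, with $p,q$ adjacent iff $q=p\mathrm{g}_{12}$ or $q\in\{p\mathrm{g}_i^+,p\mathrm{g}_i^-\}$ for some $i\in\{3,\dots,n\}$. *)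

(* Defs.v *)
From mathcomp Require Import all_boot all_order all_fingroup.
Set Implicit Arguments. Unset Strict Implicit. Unset Printing Implicit Defensive.

Definition del_rel (T : finType) (e : rel T) (F : {set T}) : rel T :=
  fun x y => [&& x \notin F, y \notin F & e x y].

Definition ncomp_del (T : finType) (e : rel T) (F : {set T}) : nat :=
  n_comp (del_rel e F) (~: F).

Definition lcut (T : finType) (e : rel T) (l : nat) (F : {set T}) : bool :=
  (l <= ncomp_del e F) || (#|~: F| < l).

(* l-component connectivity: minimum size of an l-component cut
   (the set of all vertices is always such a cut for l >= 1) *)
Definition kappa_l (T : finType) (e : rel T) (l : nat) : nat :=
  \big[minn/#|T|]_(F : {set T} | lcut e l F) #|F|.

(* A permutation p of {0,...,n-1} is written as the word p_1 ... p_n with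
   p_{k+1} = p k (positions and symbols shifted to start at 0). *)
Definition word (n : nat) (p : {perm 'I_n}) : seq nat :=
  [seq val (p i) | i <- enum 'I_n].

Definition g12 (w : seq nat) : seq nat :=
  set_nth 0 (set_nth 0 w 0 (nth 0 w 1)) 1 (nth 0 w 0).

Definition gplus (i : nat) (w : seq nat) : seq nat :=
  set_nth 0 (set_nth 0 (set_nth 0 w 0 (nth 0 w i)) 1 (nth 0 w 0)) i (nth 0 w 1).

Definition gminus (i : nat) (w : seq nat) : seq nat :=
  set_nth 0 (set_nth 0 (set_nth 0 w 0 (nth 0 w 1)) 1 (nth 0 w i)) i (nth 0 w 0).

(* adjacency in S_n^2: q = p g_12, or q in {p g_i^+, p g_i^-} for some
   paper index i in {3..n}, i.e. 0-indexed position i in {2..n-1} *)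
Definition splitstar_adj (n : nat) : rel {perm 'I_n} :=
  fun p q =>
    (word q == g12 (word p)) ||
    [exists i : 'I_n, (2 <= val i) &&
       ((word q == gplus i (word p)) || (word q == gminus i (word p)))].

(* Main.v *)
Require Import Defs.
From mathcomp Require Import all_boot all_order all_fingroup.
From mathcomp Require Import zify.
Set Implicit Arguments. Unset Strict Implicit. Unset Printing Implicit Defensive.

(* Components are handled through colourings: if a colouring of S_m^2 - F that is
   constant along edges uses s + 1 colours, then |F| is at least
   0, 2m-3, 4m-8, 6m-14, 8m-20 for s = 0, 1, 2, 3, >= 4.  For m = 4 this is a
   verified search.  For the step, split S_{m+1}^2 into the m + 1 copies of
   S_m^2 given by the last symbol.  The edges between copies form disjoint
   triangles, each meeting three different copies.  If |F| < 8(m+1) - 20, at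
   most three copies are bad (see several colours), the others all carry one
   main colour, and every vertex of another colour lies in a bad copy.  Each such
   vertex forces the part of its triangle outside the bad copies into F, and
   triangles of vertices of different colours are disjoint; adding this to the
   induction hypothesis for the bad copies suffices, except when the extra
   colours split as 1+3 over two bad copies or as 1+1+1 or 1+1+2 over three,
   where further vertices of F are found near a vertex of an extra colour.
   The bounds are attained by neighbourhoods of 2, 3, 4 independent vertices
   that agree outside the first four positions. *)

(** * Vertices, neighbours and blocks *)

Section SplitStar.
Local Open Scope group_scope.
Variable n' : nat.
Local Notation n := n'.+4.
Local Notation T := {perm 'I_n}.
Implicit Types (p q u v x y : T) (i j k z : 'I_n) (e : bool) (m : nat).

(** The first two positions are indexed by a boolean, so that exchanging [e] and [~~ e] exchanges
    [g_i^+] and [g_i^-] and one argument covers both. *)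
Definition pos e : 'I_n :=
  if e then @Ordinal n 1 isT else @Ordinal n 0 isT.

(* The neighbours of a vertex p are sw * p and rot3 e i * p (2 <= i < n), where
   rot3 false i and rot3 true i realise g_i^+ and g_i^-: a perm acts on the
   left by rearranging positions. *)
Definition sw : T := tperm (pos false) (pos true).
Definition rot3 e i : T := tperm (pos e) (pos (~~ e)) * tperm (pos (~~ e)) i.

Lemma val_pos e : val (pos e) = e.
Proof. by case: e. Qed.

Lemma pos_lt2 e : pos e < 2.
Proof. by rewrite val_pos; case: e. Qed.

Lemma pos_neq e i : 2 <= i -> (pos e == i) = false.
Proof. by move=> hi; apply/eqP => h; have := pos_lt2 e; rewrite h ltnNge hi. Qed.

Lemma pos_eqF e : (pos e == pos (~~ e)) = false.
Proof. by case: e. Qed.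

Lemma posP i : i < 2 -> exists e, i = pos e.
Proof.
by case: i => [[|[|k]]] hk //= _; [exists false | exists true]; apply: val_inj.
Qed.

Lemma sw_pos p e : (sw * p) (pos e) = p (pos (~~ e)).
Proof. by rewrite permM; case: e; rewrite ?tpermL ?tpermR. Qed.

Lemma sw_out p i : 2 <= i -> (sw * p) i = p i.
Proof. by move=> hi; rewrite permM tpermD // pos_neq. Qed.

Lemma rot3_pos p e i : 2 <= i -> (rot3 e i * p) (pos e) = p i.
Proof. by move=> hi; rewrite /rot3 !permM !tpermL. Qed.

Lemma rot3_posN p e i : 2 <= i -> (rot3 e i * p) (pos (~~ e)) = p (pos e).
Proof.
by move=> hi; rewrite /rot3 !permM (tpermR (pos e)) tpermD // 1?eq_sym ?pos_eqF ?pos_neq.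
Qed.

Lemma rot3_idx p e i : 2 <= i -> (rot3 e i * p) i = p (pos (~~ e)).
Proof.
move=> hi; rewrite /rot3 !permM [tperm (pos e) _ _]tpermD ?pos_neq //.
by rewrite (tpermR (pos (~~ e))).
Qed.

Lemma rot3_out p e i j : 2 <= j -> j != i -> (rot3 e i * p) j = p j.
Proof.
by move=> hj ji; rewrite /rot3 !permM !tpermD ?pos_neq // eq_sym.
Qed.

Lemma eq_perm_pos p q :
  (forall e, p (pos e) = q (pos e)) -> (forall i, 2 <= i -> p i = q i) -> p = q.
Proof.
move=> h1 h2; apply/permP => i; case: (leqP 2 i) => [/h2 //|/posP[e ->]]; exact: h1.
Qed.

Lemma eq_perm_at e p q :
  p (pos e) = q (pos e) -> p (pos (~~ e)) = q (pos (~~ e)) ->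
  (forall i, 2 <= i -> p i = q i) -> p = q.
Proof. by move=> h1 h2; apply: eq_perm_pos => f; case: e f h1 h2 => -[]. Qed.

Definition rots m p : {set T} :=
  [set rot3 w.1 w.2 * p | w : bool * 'I_n & 2 <= w.2 < m].

Definition nb m p : {set T} := sw * p |: rots m p.

Lemma nbP m p q :
  reflect (q = sw * p \/ exists e i, 2 <= i < m /\ q = rot3 e i * p) (q \in nb m p).
Proof.
rewrite !inE; apply: (iffP orP) => [[/eqP->|/imsetP[[e i]]]|[->|[e [i [hi ->]]]]].
- by left.
- by rewrite inE /= => hi ->; right; exists e, i.
- by left; rewrite eqxx.
- by right; apply/imsetP; exists (e, i); rewrite ?inE.
Qed.

(* The words that agree with p0 from position m on: with the adjacency nb m,
   this is a copy of S_m^2. *)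
Definition block m p0 : {set T} :=
  [set p : T | [forall i : 'I_n, (m <= i) ==> (p i == p0 i)]].

Lemma blockP m p0 p : reflect (forall i, m <= i -> p i = p0 i) (p \in block m p0).
Proof.
rewrite inE; apply: (iffP forallP) => h i; first by move/(implyP (h i))/eqP.
by apply/implyP => /h->.
Qed.

Lemma block_refl m p : p \in block m p.
Proof. by apply/blockP. Qed.

Lemma nb_block m p0 p q : 2 <= m -> p \in block m p0 -> q \in nb m p -> q \in block m p0.
Proof.
move=> hm /blockP hp /nbP[->|[e [i [/andP[h2 hi] ->]]]]; apply/blockP => j hj.
  by rewrite sw_out ?hp // (leq_trans hm).
by rewrite rot3_out ?hp // ?(leq_trans hm) // neq_ltn (leq_trans hi hj) orbT.
Qed.

Lemma rot3_inj e i e' i' p : 2 <= i -> 2 <= i' ->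
  rot3 e i * p = rot3 e' i' * p -> (e, i) = (e', i').
Proof.
move=> hi hi' h.
have E : i = i'.
  have := congr1 (fun q : T => q i) h; rewrite rot3_idx //.
  case: (eqVneq i i') => // ii'; rewrite rot3_out // => /perm_inj/eqP.
  by rewrite pos_neq.
subst i'; congr (_, _).
have := congr1 (fun q : T => q i) h; rewrite !rot3_idx // => /perm_inj/eqP.
by case: e h; case: e'.
Qed.

Lemma rot3_sw_neq e i p : 2 <= i -> rot3 e i * p <> sw * p.
Proof.
move=> hi /(congr1 (fun q : T => q i)); rewrite rot3_idx // sw_out //.
by move=> /perm_inj/eqP; rewrite pos_neq.
Qed.

Lemma card_lt_ord (k : nat) : k <= n -> #|[set i : 'I_n | i < k]| = k.
Proof.
move=> hk; have inj : injective (widen_ord hk).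
  by move=> a b /(congr1 val) h; apply: val_inj.
rewrite -[RHS]card_ord -(card_imset _ inj).
apply: eq_card => i; rewrite !inE; apply/idP/imsetP => [h|[j _ ->] /=]; last exact: ltn_ord.
by exists (Ordinal h) => //; apply: val_inj.
Qed.

Lemma card_ge2 m : m <= n -> #|[set i : 'I_n | 2 <= i < m]| = m - 2.
Proof.
move=> hm.
have -> : [set i : 'I_n | 2 <= i < m] =
  [set i : 'I_n | i < m] :\: [set i : 'I_n | i < minn 2 m].
  by apply/setP => i; rewrite !inE; lia.
rewrite cardsD (setIidPr _).
  by rewrite (@card_lt_ord m) // (@card_lt_ord (minn 2 m)); lia.
by apply/subsetP => i; rewrite !inE; lia.
Qed.

Lemma card_rots m p : 2 <= m <= n -> #|rots m p| = (2 * (m - 2))%N.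
Proof.
move=> /andP[h2 hm]; rewrite card_in_imset; last first.
  move=> [e i] [e' i']; rewrite !inE /= => /andP[hi _] /andP[hi' _].
  exact: rot3_inj.
have <- : #|setX [set: bool] [set i : 'I_n | 2 <= i < m]| = (2 * (m - 2))%N.
  by rewrite cardsX cardsT card_bool card_ge2.
by apply: eq_card => -[e i]; rewrite !inE.
Qed.

Lemma card_nb m p : 2 <= m <= n -> #|nb m p| = (2 * m - 3)%N.
Proof.
move=> hm; rewrite cardsU1 card_rots //.
suff -> : sw * p \notin rots m p by lia.
apply/imsetP => -[[e i]]; rewrite inE /= => /andP[hi _] h.
by case: (@rot3_sw_neq e i p).
Qed.

Lemma rot3N_pos p e i : 2 <= i -> (rot3 (~~ e) i * p) (pos e) = p (pos (~~ e)).
Proof. by move=> hi; have := rot3_posN p (~~ e) hi; rewrite negbK. Qed.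

Lemma rot3N_idx p e i : 2 <= i -> (rot3 (~~ e) i * p) i = p (pos e).
Proof. by move=> hi; rewrite rot3_idx // negbK. Qed.

Lemma rot3K e i p : 2 <= i -> rot3 (~~ e) i * (rot3 e i * p) = p.
Proof.
move=> hi; apply: (@eq_perm_at e) => [||j hj].
- by rewrite rot3N_pos // rot3_posN.
- by rewrite rot3_pos // rot3_idx.
- case: (eqVneq j i) => [->|ji]; last by rewrite !rot3_out.
  by rewrite rot3N_idx // rot3_pos.
Qed.

(** [rot3 e i] is a 3-cycle of positions, so its square is its inverse; hence [p] and its two
    rotations at [i] form a triangle. *)
Lemma rot3_rot e i p : 2 <= i -> rot3 e i * (rot3 e i * p) = rot3 (~~ e) i * p.
Proof.
move=> hi; apply: (@eq_perm_at e) => [||j hj].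
- by rewrite rot3_pos // rot3_idx // rot3N_pos.
- by rewrite rot3_posN // !rot3_pos.
- case: (eqVneq j i) => [->|ji]; last by rewrite !rot3_out.
  by rewrite rot3N_idx // rot3_idx // rot3_posN.
Qed.

End SplitStar.

(* The claimed minimum size of a cut of S_m^2 leaving s + 1 components; it is
   constant for s >= 4. *)
Definition gb (m s : nat) : nat :=
  match s with
  | 0 => 0
  | 1 => 2 * m - 3
  | 2 => 4 * m - 8
  | 3 => 6 * m - 14
  | _ => 8 * m - 20
  end.

Lemma gb_mono m s t : 4 <= m -> s <= t -> gb m s <= gb m t.
Proof. by move=> hm; case: s => [|[|[|[|s]]]]; case: t => [|[|[|[|t]]]] //=; lia. Qed.

(** * A verified search for the 24-vertex split-star *)

(* State of a vertex that is still to be treated: no treated neighbour has a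
   colour yet, exactly one colour (named by its rank of appearance) occurs among
   them, or two colours occur and the vertex must be deleted. *)
Inductive status := Free | Owned of nat | Blocked.

Definition is_free (s : status) := if s is Free then true else false.
Definition is_blocked (s : status) := if s is Blocked then true else false.

Definition touch1 (c : nat) (s : status) : status :=
  match s with
  | Free => Owned c
  | Owned d => if c == d then s else Blocked
  | Blocked => Blocked
  end.

Fixpoint touch (c : nat) (a : seq bool) (st : seq status) : seq status :=
  match a, st with
  | b :: a', s :: st' => (if b then touch1 c s else s) :: touch c a' st'
  | _, _ => st
  end.

(* f counts the deleted vertices and r the colours so far.  A branch is cut as
   soon as all free vertices together could not violate the bound. *)
Fixpoint search (adj : seq (seq bool)) (st : seq status) (f r : nat) : bool :=
  if gb 4 (r + count is_free st).-1 <= f + count is_blocked st then true else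
  match adj, st with
  | a :: adj', s :: st' =>
    if search adj' st' f.+1 r then
      match s with
      | Blocked => true
      | Owned c => search adj' (touch c a st') f r
      | Free =>
        if all (fun c => search adj' (touch c a st') f r) (iota 0 r)
        then search adj' (touch r a st') f r.+1 else false
      end
    else false
  | _, _ => false
  end.

(** Each row covers only the later vertices, because [search] treats the vertices in order and its
    list of states shrinks with them. *)
Fixpoint adjl (W : Type) (e : rel W) (ws : seq W) : seq (seq bool) :=
  if ws is w :: ws' then map (e w) ws' :: adjl e ws' else [::].

(** * Soundness of the search *)

Section Soundness.
Variables (W K : eqType) (e : rel W) (a : W -> option K).

(** The search invariant for a fixed colouring [a], where [None] means deleted: [cs] lists the
    colours met so far in order of appearance, and a state must not contradict the actual value at
    [w]. *)
Definition fits (cs : seq K) (w : W) (s : status) : bool :=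
  match s with
  | Free => true
  | Owned c => (c < size cs) && ((a w == None) || (a w == ohead (drop c cs)))
  | Blocked => a w == None
  end.

Fixpoint fits_all (cs : seq K) (ws : seq W) (st : seq status) : bool :=
  match ws, st with
  | w :: ws', s :: st' => fits cs w s && fits_all cs ws' st'
  | [::], [::] => true
  | _, _ => false
  end.

Lemma ohead_drop (cs : seq K) c : ohead (drop c cs) = onth cs c.
Proof. by elim: cs c => [|x cs IH] [|c] //=. Qed.

Lemma onth_lt (k : K) (cs : seq K) c : c < size cs -> onth cs c = Some (nth k cs c).
Proof. by move=> h; rewrite onthE (nth_map k). Qed.

Definition properly (ws : seq W) :=
  {in ws &, forall x y, e x y -> a x != None -> a y != None -> a x = a y}.

(** A neighbour of [w] is deleted or shares the colour of [w]. If a different rank already owns it,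
    only deletion remains, which is what [Blocked] records. *)
Lemma fits_touch cs w k c ws st :
  uniq cs -> onth cs c = Some k -> a w = Some k ->
  (forall x, x \in ws -> e w x -> a x != None -> a x = Some k) ->
  fits_all cs ws st -> fits_all cs ws (touch c (map (e w) ws) st).
Proof.
move=> ucs ck aw; elim: ws st => [|x ws IH] [|s st] //= h /andP[fs fa].
rewrite IH ?andbT //; last by move=> y hy; apply: h; rewrite inE hy orbT.
case: ifP => // ewx.
have {}h : a x != None -> a x = Some k by apply: h => //; rewrite inE eqxx.
have cl : c < size cs.
  by rewrite -onthTE ck.
case: s fs => [_|d|] //=.
  rewrite cl ohead_drop ck /=.
  by case: (eqVneq (a x) None) => //= /h ->; rewrite eqxx.
move=> /andP[dl]; rewrite ohead_drop.
case: (eqVneq c d) => [<-|cd] /=; first by rewrite cl ohead_drop => ->.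
case: (eqVneq (a x) None) => //= nx /eqP; rewrite h // => /esym dk.
case/eqP: cd; move: ck dk.
rewrite !(onth_lt k) // => -[ck] [/eqP]; rewrite -{2}ck nth_uniq //.
by move/eqP.
Qed.

Lemma fits_rcons cs k ws st : fits_all cs ws st -> fits_all (rcons cs k) ws st.
Proof.
elim: ws st => [|x ws IH] [|s st] //= /andP[fs /IH ->]; rewrite andbT.
case: s fs => //= c /andP[cl]; rewrite !ohead_drop size_rcons ltnS ltnW //=.
have -> // : onth (rcons cs k) c = onth cs c.
by rewrite (onth_lt k) ?size_rcons 1?ltnW // (onth_lt k) // nth_rcons cl.
Qed.

Lemma fits_blocked cs ws st : fits_all cs ws st ->
  count is_blocked st <= count (fun w => a w == None) ws.
Proof.
elim: ws st => [|x ws IH] [|s st] //= /andP[fs /IH h].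
by apply: leq_add => //; case: s fs => //= ->.
Qed.

(** Only free vertices can bring a colour outside [cs]: an owned vertex repeats one of [cs] or is
    deleted, and a blocked one is deleted. *)
Lemma fits_free cs ws st (ds : seq K) : fits_all cs ws st -> uniq ds ->
  {subset ds <= cs ++ pmap a ws} -> size ds <= size cs + count is_free st.
Proof.
move=> hf uds sub.
suff [l hl sl] : exists2 l, size l <= count is_free st & {subset pmap a ws <= cs ++ l}.
  apply: leq_trans (leq_add (leqnn _) hl); rewrite -size_cat; apply: uniq_leq_size => // d.
  by move/sub; rewrite mem_cat => /orP[h|/sl //]; rewrite mem_cat h.
elim: ws st hf {sub} => [|x ws IH] [|s st] //=; first by exists [::].
move=> /andP[fs /IH[l hl sl]].
case ax: (a x) => [k|] /=; last first.
  by exists l => //; apply: leq_trans hl _; apply: leq_addl.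
case: s fs => [_|c /=|/=]; rewrite ?ax //.
  exists (k :: l) => //= y; rewrite inE => /orP[/eqP->|/sl].
    by rewrite mem_cat inE eqxx orbT.
  by rewrite !mem_cat inE => /orP[->//|->]; rewrite !orbT.
rewrite ohead_drop => /andP[cl /eqP ck]; exists l => // y.
rewrite inE => /orP[/eqP->|/sl //]; rewrite mem_cat.
move: ck; rewrite (onth_lt k) // => -[->]; rewrite mem_nth //.
Qed.

Lemma search_prune ws st f cs (ds : seq K) : fits_all cs ws st -> uniq ds ->
  {subset ds <= cs ++ pmap a ws} ->
  gb 4 (size cs + count is_free st).-1 <= f + count is_blocked st ->
  gb 4 (size ds).-1 <= f + count (fun w => a w == None) ws.
Proof.
move=> fa uds sub h; apply: leq_trans (leq_trans h _).
  by apply: gb_mono => //; rewrite -!subn1 leq_sub2r // (fits_free fa).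
by rewrite leq_add2l (fits_blocked fa).
Qed.

(** The induction follows the branch prescribed by [a]: deletion, a known colour, or a first
    occurrence, which receives rank [size cs]. One name for a new colour is enough because ranks
    follow the order of appearance. *)
Lemma search_sound ws st f cs (ds : seq K) :
  search (adjl e ws) st f (size cs) -> fits_all cs ws st -> uniq cs -> properly ws ->
  uniq ds -> {subset ds <= cs ++ pmap a ws} ->
  gb 4 (size ds).-1 <= f + count (fun w => a w == None) ws.
Proof.
elim: ws st f cs => [|w ws IH] st f cs sc fa ucs pr uds sub.
  by move: sc => /=; case: ifP => // /(search_prune fa uds sub).
move: sc => /=; case: ifP => [/(search_prune fa uds sub) //|_].
case: st fa => [|s st] //= /andP[fs fa].
have prw : properly ws.
  by move=> x y hx hy; apply: pr; rewrite inE ?hx ?hy orbT.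
case: ifP => // sF; case aw : (a w) => [k|] /=; last first.
  move=> _; rewrite addnA addn1; apply: (IH st f.+1 cs) => //.
  by move=> d /sub; rewrite /= aw.
have hk x : x \in ws -> e w x -> a x != None -> a x = Some k.
  move=> hx ewx ax; rewrite -aw; symmetry; apply: pr => //.
  - by rewrite inE eqxx.
  - by rewrite inE hx orbT.
  - by rewrite aw.
rewrite add0n.
have known c : onth cs c = Some k -> search (adjl e ws) (touch c (map (e w) ws) st) f (size cs) ->
    gb 4 (size ds).-1 <= f + count (fun w => a w == None) ws.
  move=> ck sc; apply: (IH _ _ cs sc) => //; first exact: (fits_touch (k := k) ucs ck aw hk fa).
  move=> d /sub; rewrite /= aw /= !mem_cat inE => /orP[->//|/orP[/eqP->|->]]; last by rewrite orbT.
  have cl : c < size cs by rewrite -onthTE ck.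
  by move: ck; rewrite (onth_lt k) // => -[<-]; rewrite mem_nth.
case: s fs => [_|c|] /=; rewrite ?aw //=; last first.
  by rewrite ohead_drop => /andP[cl /eqP/esym ck]; apply: known.
case: ifP => // /allP hall sN.
case: (boolP (k \in cs)) => kcs.
  have ki : onth cs (index k cs) = Some k by rewrite (onth_lt k) ?index_mem // nth_index.
  by apply: known ki _; apply: hall; rewrite mem_iota add0n index_mem.
have sN' : search (adjl e ws) (touch (size cs) (map (e w) ws) st) f (size (rcons cs k)).
  by rewrite size_rcons.
apply: (IH _ _ _ sN') => //.
- apply: (fits_touch (k := k)) => //; first by rewrite rcons_uniq kcs.
    by rewrite (onth_lt k) ?size_rcons // nth_rcons ltnn eqxx.
  exact: fits_rcons.
- by rewrite rcons_uniq kcs.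
move=> d /sub; rewrite /= aw /= !mem_cat mem_rcons !inE.
by case/orP=> [->|/orP[->|->]]; rewrite ?orbT.
Qed.
End Soundness.

(** All 24 words of length four. Soundness holds for any order of the vertices; the order only
    affects how early branches are cut. *)
Definition words4 : seq (seq nat) :=
  [:: [:: 0; 3; 2; 1]; [:: 1; 0; 2; 3]; [:: 1; 2; 3; 0]; [:: 0; 2; 3; 1];
      [:: 1; 2; 0; 3]; [:: 3; 2; 1; 0]; [:: 1; 3; 0; 2]; [:: 0; 3; 1; 2];
      [:: 1; 3; 2; 0]; [:: 0; 2; 1; 3]; [:: 2; 3; 0; 1]; [:: 0; 1; 3; 2];
      [:: 2; 3; 1; 0]; [:: 0; 1; 2; 3]; [:: 1; 0; 3; 2]; [:: 2; 1; 0; 3];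
      [:: 2; 0; 3; 1]; [:: 3; 0; 2; 1]; [:: 3; 2; 0; 1]; [:: 3; 1; 0; 2];
      [:: 3; 1; 2; 0]; [:: 3; 0; 1; 2]; [:: 2; 0; 1; 3]; [:: 2; 1; 3; 0]].

Definition nbw (w : seq nat) : seq (seq nat) :=
  [:: g12 w; gplus 2 w; gminus 2 w; gplus 3 w; gminus 3 w].

Definition adjw (w w' : seq nat) : bool := w' \in nbw w.

Definition adj4 := Eval vm_compute in adjl adjw words4.

Lemma adj4E : adj4 = adjl adjw words4.
Proof. by vm_compute. Qed.

Lemma search4 : search adj4 (nseq 24 Free) 0 0.
Proof. by vm_compute. Qed.

(** * The base case *)

Section Base.
Local Open Scope group_scope.
Variable n' : nat.
Local Notation n := n'.+4.
Local Notation T := {perm 'I_n}.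
Implicit Types (p q u v x y : T) (w : seq nat).

Definition wfun w (x : 'I_n) : 'I_n := if x < 4 then inord (nth 0 w x) else x.
(** [w] acts on the first four positions and the others are fixed; for a [good] word the default is
    never reached. The products [pw w * p0] run through the block of [p0]. *)
Definition pw w : T := odflt (1 : T) (insub [ffun x => wfun w x] : option T).

Definition good w := perm_eq w (iota 0 4).

Lemma good_words : all good words4.
Proof. by vm_compute. Qed.

Lemma good_nbw : all (fun w => all good (nbw w)) words4.
Proof. by vm_compute. Qed.

Lemma mem_words4 w : (w \in words4) = good w.
Proof.
rewrite /good -mem_permutations; apply: perm_mem; by vm_compute.
Qed.

Lemma good_lt w k : good w -> k < 4 -> nth 0 w k < 4.
Proof.
move=> gw hk; have sz := perm_size gw.
have : nth 0 w k \in w by rewrite mem_nth // sz.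
by rewrite (perm_mem gw) mem_iota.
Qed.

Lemma val_wfun w (x : 'I_n) : good w -> val (wfun w x) = if x < 4 then nth 0 w x else x.
Proof.
move=> gw; rewrite /wfun; case: ifP => // hx.
by rewrite /= inordK //; apply: leq_trans (good_lt gw hx) _.
Qed.

Lemma pwE w (x : 'I_n) : good w -> pw w x = wfun w x.
Proof.
move=> gw; have inj : injective (wfun w).
  move=> y z /(congr1 val); rewrite !val_wfun //.
  have uw : uniq w by rewrite (perm_uniq gw) iota_uniq.
  have sz := perm_size gw.
  case: ifP => hy; case: ifP => hz.
  - by move/eqP; rewrite nth_uniq ?sz // => /eqP/val_inj.
  - by move=> h; have := good_lt gw hy; rewrite h hz.
  - by move=> h; have := good_lt gw hz; rewrite -h hy.
  - by move/val_inj.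
rewrite /pw insubT /=.
  by apply/injectiveP => y z; rewrite !ffunE => /inj.
by move=> h; rewrite -pvalE /= ffunE.
Qed.

Lemma pw_val w (x : 'I_n) : good w -> val (pw w x) = if x < 4 then nth 0 w x else x.
Proof. by move=> gw; rewrite pwE // val_wfun. Qed.

Lemma pw_inj w w' : good w -> good w' -> pw w = pw w' -> w = w'.
Proof.
move=> gw gw' h; apply: (@eq_from_nth _ 0); first by rewrite (perm_size gw) (perm_size gw').
move=> k; rewrite (perm_size gw) => /= hk.
have kn : k < n by apply: leq_trans hk _.
by have := pw_val (Ordinal kn) gw; rewrite h pw_val //= hk.
Qed.

Lemma ord_lt4 (i : 'I_n) : 2 <= i < 4 -> (i = @Ordinal n 2 isT) \/ (i = @Ordinal n 3 isT).
Proof.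
by case: i => -[|[|[|[|k]]]] hk //= _; [left|right]; apply: val_inj.
Qed.

Lemma pw_sw w : good w -> good (g12 w) -> sw _ * pw w = pw (g12 w).
Proof.
move=> gw gw'; apply: eq_perm_pos => [e|i hi]; apply: val_inj.
- by rewrite sw_pos !pw_val //; case: e; rewrite /g12; do !rewrite nth_set_nth /=.
- rewrite sw_out // !pw_val //; case: ifP => // hi4.
  by case: (@ord_lt4 i) => [|->|->]; rewrite ?hi ?hi4 // /g12; do !rewrite nth_set_nth /=.
Qed.

Lemma pw_rot e (i : 'I_n) w : good w -> 2 <= i < 4 ->
  let w' := (if e then gminus i w else gplus i w) in
  good w' -> rot3 e i * pw w = pw w'.
Proof.
move=> gw hi w' gw'; have hi2 : 2 <= i by case/andP: hi.
apply/(@eq_perm_at _ e) => [||j hj]; apply: val_inj.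
- rewrite rot3_pos // !pw_val // /w'.
  by case: e w' gw' => w' gw'; case: (ord_lt4 hi) => ->;
    rewrite /gplus /gminus; do !rewrite nth_set_nth /=.
- rewrite rot3_posN // !pw_val // /w'.
  by case: e w' gw' => w' gw'; case: (ord_lt4 hi) => ->;
    rewrite /gplus /gminus; do !rewrite nth_set_nth /=.
case: (eqVneq j i) => [->|ji].
  rewrite rot3_idx // !pw_val // /w'.
  by case: e w' gw' => w' gw'; case: (ord_lt4 hi) => ->;
    rewrite /gplus /gminus; do !rewrite nth_set_nth /=.
rewrite rot3_out // !pw_val //; case: ifP => // hj4; rewrite /w' /gplus /gminus.
have j0 : (j == 0 :> nat) = false by case: (nat_of_ord j) hj.
have j1 : (j == 1%N :> nat) = false by case: (nat_of_ord j) hj => [|[|?]].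
have ji' : (j == i :> nat) = false by apply/negbTE.
by case: (e); do !rewrite nth_set_nth /= ?ji' ?j0 ?j1.
Qed.

Lemma nb_pw w p0 q : w \in words4 -> q \in nb 4 (pw w * p0) ->
  exists2 w', w' \in nbw w & q = pw w' * p0.
Proof.
move=> hw; have gw := allP good_words _ hw; have /allP gn := allP good_nbw _ hw.
case/nbP => [->|[e [i [hi ->]]]]; rewrite mulgA.
  exists (g12 w); first by rewrite inE eqxx.
  by rewrite pw_sw // gn // inE eqxx.
exists (if e then gminus i w else gplus i w).
  by case: (ord_lt4 hi) => ->; case: (e); rewrite !inE eqxx ?orbT.
rewrite pw_rot // gn //.
by case: (ord_lt4 hi) => ->; case: (e); rewrite !inE eqxx ?orbT.
Qed.

Lemma pw_nb w w' p0 : w \in words4 -> w' \in nbw w -> pw w' * p0 \in nb 4 (pw w * p0).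
Proof.
move=> hw; have gw := allP good_words _ hw; have /allP gn := allP good_nbw _ hw => hw'.
have gw' := gn _ hw'; apply/nbP; rewrite !mulgA.
move: hw' gw'; rewrite !inE => /orP[/eqP->|/orP[/eqP->|/orP[/eqP->|/orP[/eqP->|/eqP->]]]] gw'.
- by left; rewrite pw_sw.
- by right; exists false, (@Ordinal n 2 isT); split=> //; rewrite mulgA pw_rot.
- by right; exists true, (@Ordinal n 2 isT); split=> //; rewrite mulgA pw_rot.
- by right; exists false, (@Ordinal n 3 isT); split=> //; rewrite mulgA pw_rot.
- by right; exists true, (@Ordinal n 3 isT); split=> //; rewrite mulgA pw_rot.
Qed.

Lemma pw_block w p0 : good w -> pw w * p0 \in block 4 p0.
Proof.
move=> gw; apply/blockP => i hi; rewrite permM; congr (p0 _).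
by apply: val_inj; rewrite pw_val // ltnNge hi.
Qed.

Lemma block_pw p p0 : p \in block 4 p0 -> exists2 w, good w & p = pw w * p0.
Proof.
move=> /blockP hp.
(* Letter [k] is the position at which [p0] carries the symbol that [p] has at [k]; agreement of [p]
   and [p0] from position 4 on keeps it below 4. *)
pose f (k : nat) : nat := p0^-1 (p (inord k)).
have flt k : k < 4 -> f k < 4.
  move=> hk; rewrite /f ltnNge; apply/negP => h; have := hp _ h.
  rewrite permKV => /perm_inj/(congr1 val) /= E; move: h.
  by rewrite E inordK; [rewrite leqNgt hk | apply: leq_trans hk _].
have gw : good (map f (iota 0 4)).
  have uw : uniq (map f (iota 0 4)).
    rewrite map_inj_in_uniq ?iota_uniq // => a b; rewrite !mem_iota /= => ha hb.
    move/val_inj/perm_inj/perm_inj/(congr1 val); rewrite /= !inordK //.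
    - exact: leq_trans hb _.
    - exact: leq_trans ha _.
  apply: uniq_perm; rewrite ?iota_uniq //.
  have sub : {subset map f (iota 0 4) <= iota 0 4}.
    by move=> x /mapP[k]; rewrite !mem_iota /= => /flt h ->.
  by case: (uniq_min_size uw sub) => //; rewrite size_map.
exists (map f (iota 0 4)) => //; apply/permP => i; rewrite permM.
case: (ltnP i 4) => hi; last first.
  by rewrite hp //; congr (p0 _); apply: val_inj; rewrite pw_val // ltnNge hi.
have -> : pw [seq f i | i <- iota 0 4] i = p0^-1 (p i); last by rewrite permKV.
apply: val_inj; rewrite pw_val // hi (nth_map 0) ?size_iota // nth_iota // add0n /f.
by rewrite inord_val.
Qed.

Variable K : finType.
Implicit Types (F X : {set T}) (c : T -> K).

Definition compat m X F c :=
  {in X :\: F &, forall x y, y \in nb m x -> c x = c y}.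

Lemma base4 p0 F c : compat 4 (block 4 p0) F c ->
  gb 4 #|c @: (block 4 p0 :\: F)|.-1 <= #|block 4 p0 :&: F|.
Proof.
move=> hc.
pose a w := if pw w * p0 \in F then None else Some (c (pw w * p0)).
pose ds := enum (c @: (block 4 p0 :\: F)).
have pr : properly adjw a words4.
  move=> w w' hw hw' ww'; rewrite /a; case: ifP => // h; case: ifP => // h' _ _.
  congr Some; apply: hc; last exact: pw_nb.
    by rewrite inE h pw_block // (allP good_words).
  by rewrite inE h' pw_block // (allP good_words).
have sub : {subset ds <= [::] ++ pmap a words4}.
  move=> d; rewrite mem_enum => /imsetP[p]; rewrite inE => /andP[pF].
  case/block_pw => w gw pE ->; rewrite cat0s mem_pmap; apply/mapP; exists w.
    by rewrite mem_words4.
  by rewrite /a -pE (negPf pF).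
have h : gb 4 (size ds).-1 <= 0 + count (fun w => a w == None) words4.
  apply: (@search_sound _ K adjw a words4 (nseq 24 Free) 0 [::]) sub; [|by []..|exact: enum_uniq].
  by rewrite -adj4E; exact: search4.
rewrite -cardE add0n in h; apply: leq_trans h _.
rewrite -size_filter -(size_map (fun w => pw w * p0)) cardE.
apply: uniq_leq_size.
  rewrite map_inj_in_uniq; first by rewrite filter_uniq.
  move=> w w'; rewrite !mem_filter => /andP[_ hw] /andP[_ hw'] /mulIg.
  by apply: pw_inj; rewrite -mem_words4.
move=> p /mapP[w]; rewrite mem_filter => /andP[aw hw] ->.
rewrite mem_enum inE pw_block ?(allP good_words) //=.
by move: aw; rewrite /a; case: ifP.
Qed.
End Base.

(** * The induction step *)

Section Step.
Local Open Scope group_scope.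
Variable n' : nat.
Local Notation n := n'.+4.
Local Notation T := {perm 'I_n}.
Local Notation pos := (pos n').
Variables (K : finType) (m : nat) (z : 'I_n) (p0 : T) (F : {set T}) (c : T -> K).
Hypotheses (hm : 4 <= m) (hz : z = m :> nat).
Local Notation X := (block m.+1 p0).
Hypothesis hc : compat m.+1 X F c.
Hypothesis IH : forall p (G : {set T}) (d : T -> K), compat m (block m p) G d ->
  gb m #|d @: (block m p :\: G)|.-1 <= #|block m p :&: G|.

Implicit Types (p q u v x y : T) (i j k : 'I_n) (e : bool) (A B : {set 'I_n}).

(** The two neighbours of [p] outside its copy: [tv e p] lies in the copy labelled
    [p (pos (~~ e))]. *)
Local Notation tv e p := (rot3 e z * p).

(** * Copies and the edges between them *)

Definition syms : {set 'I_n} := [set p0 i | i : 'I_n & i <= m].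
Definition copy i : {set T} := [set p in X | p z == i].
Definition cols i : {set K} := c @: (copy i :\: F).
Local Notation fc i := #|copy i :&: F|.

Let z2 : 2 <= z. Proof. by rewrite hz; lia. Qed.

Lemma card_syms : #|syms| = m.+1.
Proof.
rewrite card_imset; last exact: perm_inj.
rewrite -[RHS](@card_lt_ord n' m.+1); first by apply: eq_card => i; rewrite !inE.
by have := ltn_ord z; rewrite hz.
Qed.

Lemma sym_val p i : p \in X -> i <= m -> p i \in syms.
Proof.
move=> /blockP hp hi; apply/imsetP; exists (p0^-1 (p i)); last by rewrite permKV.
rewrite inE leqNgt; apply/negP => h; have := hp _ h; rewrite permKV => /perm_inj E.
by rewrite E ltnNge hi in h.
Qed.

Lemma tv_nb e p : tv e p \in nb m.+1 p.
Proof. by apply/nbP; right; exists e, z; rewrite z2 hz ltnSn. Qed.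

Lemma tv_X e p : p \in X -> tv e p \in X.
Proof. by move=> hp; apply: nb_block hp (tv_nb e p); lia. Qed.

Lemma nb_z p q : q \in nb m p -> q z = p z.
Proof.
case/nbP => [->|[e [i [/andP[h2 hi] ->]]]]; first by rewrite sw_out.
by rewrite rot3_out // -val_eqE /= hz neq_ltn hi orbT.
Qed.

Lemma nbW p q : q \in nb m p -> q \in nb m.+1 p.
Proof.
case/nbP => [->|[e [i [/andP[h2 hi] ->]]]]; apply/nbP; first by left.
by right; exists e, i; rewrite h2 ltnS ltnW.
Qed.

Lemma in_copy i p : (p \in copy i) = (p \in X) && (p z == i).
Proof. by rewrite /copy in_set. Qed.

Lemma nb_copy i p q : p \in copy i -> q \in nb m p -> q \in copy i.
Proof.
rewrite !in_copy => /andP[hp /eqP <-] hq; rewrite (nb_z hq) eqxx andbT.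
by apply: nb_block hp (nbW hq); lia.
Qed.

Lemma copy_block i p : p \in copy i -> copy i = block m p.
Proof.
rewrite in_copy => /andP[/blockP hp /eqP hpz]; apply/setP => q; rewrite in_copy.
apply/andP/blockP => [[/blockP hq /eqP hqz] j|hq].
  rewrite leq_eqVlt => /orP[/eqP jz|hj]; last by rewrite hp // hq.
  have -> : j = z by apply: val_inj; rewrite /= hz.
  by rewrite hpz.
split; last by rewrite hq ?hpz ?hz.
by apply/blockP => j hj; rewrite hq ?hp // ltnW.
Qed.

(** Each vertex counted starts an edge [p], [tv false p] from copy [i] to copy [j]. Two
    transpositions of symbols turn [p0] into one such vertex [p2]; permuting its other [m - 1]
    positions below [m] yields the rest. *)
Lemma card_perms_at i j : i \in syms -> j \in syms -> i != j ->
  (m.-1)`! <= #|[set p in X | (p z == i) && (p (pos true) == j)]|.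
Proof.
move=> hi hj ij.
pose p1 := p0 * tperm (p0 z) i.
pose p2 := p1 * tperm (p1 (pos true)) j.
have p1z : p1 z = i by rewrite permM tpermL.
have p2z : p2 z = i.
  by rewrite permM p1z tpermD // 1?eq_sym // -p1z (inj_eq perm_inj) eq_sym pos_neq.
have p21 : p2 (pos true) = j by rewrite permM tpermL.
have symF k (l : 'I_n) : k \in syms -> m < l -> k != p0 l.
  move=> /imsetP[t]; rewrite inE => ht -> hl; rewrite (inj_eq perm_inj).
  by apply/eqP => E; move: ht hl; rewrite E; lia.
have p1X : p1 \in X.
  apply/blockP => l hl; rewrite permM tpermD // symF //.
  by apply: imset_f; rewrite inE hz.
have p2X : p2 \in X.
  have /blockP h1 := p1X.
  apply/blockP => l hl; rewrite permM (h1 l) // tpermD // symF //.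
  by apply: sym_val => //; rewrite val_pos; lia.
pose P : {set 'I_n} := [set l : 'I_n | l < m] :\ pos true.
have cP : #|P| = m.-1.
  have := cardsD1 (pos true) [set l : 'I_n | l < m].
  rewrite card_lt_ord; last by have := ltn_ord z; rewrite hz; lia.
  have -> : pos true \in [set l : 'I_n | l < m] by rewrite inE /=; lia.
  by rewrite -/P => E; rewrite [in RHS]E.
rewrite -cP -card_perm -(card_imset _ (mulIg p2)).
apply: subset_leq_card; apply/subsetP => q /imsetP[s hs ->].
have out l : l \notin P -> (s * p2) l = p2 l.
  by move=> hl; rewrite permM (out_perm hs).
rewrite in_set !out ?p2z ?p21 ?eqxx ?andbT //.
- apply/blockP => l hl; rewrite out; first by have /blockP-> := p2X.
  by rewrite !inE negb_and -leqNgt (ltnW hl) orbT.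
- by rewrite !inE eqxx.
- by rewrite !inE hz ltnn andbF.
Qed.

Lemma copy_neq0 i : i \in syms -> exists p, p \in copy i.
Proof.
move=> hi.
have [j hj ij] : exists2 j, j \in syms & i != j.
  have : 0 < #|syms :\ i| by have := cardsD1 i syms; rewrite hi card_syms add1n => -[<-]; lia.
  by case/card_gt0P => j; rewrite !inE eq_sym => /andP[ij hj]; exists j.
have := leq_trans (fact_gt0 _) (card_perms_at hi hj ij).
by case/card_gt0P => p; rewrite in_set => /and3P[hp hpz _]; exists p; rewrite in_copy hp.
Qed.

Lemma IH_copy i : i \in syms -> gb m #|cols i|.-1 <= fc i.
Proof.
move=> /copy_neq0[p hp]; rewrite /cols (copy_block hp); apply: IH => x y hx hy xy.
have sub : {subset block m p <= X}.
  by move=> q; rewrite -(copy_block hp) in_copy => /andP[].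
move: hx hy; rewrite !in_setD => /andP[xF /sub hx] /andP[yF /sub hy].
by apply: hc (nbW xy); rewrite in_setD ?xF ?yF ?hx ?hy.
Qed.

Lemma card_F_sum : #|X :&: F| = \sum_(i in syms) fc i.
Proof.
rewrite -sum1_card (partition_big (fun p : T => p z) (mem syms)) /=; last first.
  by move=> p; rewrite in_setI => /andP[hp _]; apply: sym_val => //; rewrite hz.
apply: eq_bigr => i _; rewrite -sum1_card; apply: eq_bigl => p.
by rewrite !in_setI in_copy andbAC.
Qed.

Lemma card_F_part (A : {set 'I_n}) : A \subset syms ->
  #|[set p in X :&: F | p z \in A]| = \sum_(i in A) fc i.
Proof.
move=> hA.
rewrite -sum1_card (partition_big (fun p : T => p z) (mem A)) /=; last first.
  by move=> p; rewrite inE => /andP[].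
apply: eq_bigr => i hi; rewrite -sum1_card; apply: eq_bigl => p.
rewrite in_set !in_setI in_copy -!andbA.
by case: (eqVneq (p z) i) => [->|_]; rewrite ?hi ?andbF ?andbT //= andbC.
Qed.

(* A vertex of F covers at most two edges between copies. *)
Lemma cut_count A B : A \subset syms -> B \subset syms -> [disjoint A & B] ->
  (forall p, p \in X -> p \notin F -> tv false p \notin F ->
     ~~ ((p z \in A) && (p (pos true) \in B) || (p z \in B) && (p (pos true) \in A))) ->
  #|A| * #|B| * (m.-1)`! <= \sum_(i in A :|: B) fc i.
Proof.
move=> hA hB dAB hcut.
have hAB : A :|: B \subset syms by rewrite subUset hA.
rewrite -card_F_part //; set F' := [set p in X :&: F | _].
pose P := setX A B :|: setX B A.
pose E := [set p in X | (p z, p (pos true)) \in P].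
have cP : #|P| = (2 * (#|A| * #|B|))%N.
  rewrite cardsU (_ : _ :&: _ = set0) ?cards0 ?subn0 ?cardsX; first by lia.
  apply/setP => -[i j]; rewrite !inE /=; apply/negP => /andP[/andP[iA _] /andP[iB _]].
  by have := disjointFr dAB iA; rewrite iB.
have cE : 2 * (#|A| * #|B|) * (m.-1)`! <= #|E|.
  rewrite -cP -sum_nat_const -[#|E|]sum1_card.
  rewrite (partition_big (fun p : T => (p z, p (pos true))) (mem P)) /=; last first.
    by move=> p; rewrite inE => /andP[].
  apply: leq_sum => -[i j] hP; rewrite sum1_card.
  have [hi hj ij] : [/\ i \in syms, j \in syms & i != j].
    have nAB k : k \in A -> k \in B -> False.
      by move=> kA kB; have := disjointFr dAB kA; rewrite kB.
    move: hP; rewrite !inE /= => /orP[] /andP[iA jB].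
      rewrite (subsetP hA _ iA) (subsetP hB _ jB); split=> //.
      by apply/eqP => ij; apply: (nAB i) => //; rewrite ij.
    rewrite (subsetP hB _ iA) (subsetP hA _ jB); split=> //.
    by apply/eqP => ij; apply: (nAB j) => //; rewrite -ij.
  apply: leq_trans (card_perms_at hi hj ij) _; apply: subset_leq_card.
  apply/subsetP => p; rewrite in_set => /and3P[hp /eqP pz /eqP p1].
  by rewrite unfold_in /= in_set pz p1 hp hP eqxx.
(* [E] holds one start for each edge between [A] and [B], and one end of that edge is deleted:
   either [p] itself or [tv false p], from which [tv true] leads back. *)
have sE : E \subset F' :|: [set tv true q | q in F'].
  apply/subsetP => p; rewrite in_set => /andP[hp hP].
  have tX := tv_X false hp.
  have tz : tv false p z = p (pos true) by rewrite rot3_idx.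
  have hP' : (p z \in A) && (p (pos true) \in B) || (p z \in B) && (p (pos true) \in A).
    by move: hP; rewrite !inE.
  have [pz p1] : p z \in A :|: B /\ p (pos true) \in A :|: B.
    by case/orP: hP' => /andP[h1 h2]; rewrite !inE h1 h2 ?orbT.
  rewrite in_setU; case: (boolP (p \in F)) => pF.
    by rewrite in_set pz andbT in_setI hp pF.
  case: (boolP (tv false p \in F)) => tF; last by have := hcut p hp pF tF; rewrite hP'.
  apply/orP; right; apply/imsetP; exists (tv false p); last by rewrite (rot3K false).
  by rewrite in_set in_setI tX tF tz p1.
have := leq_trans cE (leq_trans (subset_leq_card sE) (leq_card_setU _ _)).
have := leq_imset_card (fun q => tv true q) F'.
move: #|F'| #|_ @: _|; nia.
Qed.

Lemma fact_big : 2 * m - 2 <= (m.-1)`!.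
Proof.
move: hm; case: m => [|[|[|[|k]]]] // _ /=.
elim: k => // k IHk; rewrite factS; move: IHk; move: (k.+3)`! => t; nia.
Qed.

(** With [t <= 3] copies left over, [#|A| * #|B| >= m - t], so the cut costs at least
    [(m - t) * (2 * m - 2)] by [fact_big], and the left-over copies cost [t * (2 * m - 3)]. *)
Lemma cut_bound A B : A \subset syms -> B \subset syms -> [disjoint A & B] ->
  0 < #|A| -> 0 < #|B| ->
  #|syms :\: (A :|: B)| <= 3 -> (forall i, i \in syms :\: (A :|: B) -> 2 * m - 3 <= fc i) ->
  (forall p, p \in X -> p \notin F -> tv false p \notin F ->
     ~~ ((p z \in A) && (p (pos true) \in B) || (p z \in B) && (p (pos true) \in A))) ->
  8 * m.+1 - 20 <= #|X :&: F|.
Proof.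
move=> hA hB dAB nA nB c3 hbad hcut.
have hAB : A :|: B \subset syms by rewrite subUset hA.
have := cut_count hA hB dAB hcut.
have -> : #|X :&: F| = \sum_(i in A :|: B) fc i + \sum_(i in syms :\: (A :|: B)) fc i.
  by rewrite card_F_sum (big_setID (A :|: B)) /= (setIidPr hAB).
have : \sum_(i in syms :\: (A :|: B)) (2 * m - 3) <= \sum_(i in syms :\: (A :|: B)) fc i.
  exact: leq_sum.
rewrite sum_nat_const.
have := cardsD syms (A :|: B); rewrite (setIidPr hAB) card_syms.
have := cardsUI A B; rewrite (disjoint_setI0 dAB) cards0.
have := subset_leq_card hAB; rewrite card_syms.
have := fact_big.
move: c3 (\sum_(i in _) _) (\sum_(i in _) _) nA nB.
move: #|syms :\: _| #|A :|: B| #|A| #|B| (m.-1)`! => t r a b g.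
move=> t3 s1 s2 a1 b1 hg hr rab ht hs2 hs1.
have hab : m - t <= a * b by nia.
have h1 : (m - t) * (2 * m - 2) <= s1 by apply: leq_trans hs1; apply: leq_mul.
move: hm h1 hs2 t3; clear; case: t => [|[|[|[|t]]]] //; nia.
Qed.

Lemma card_copy i : i \in syms -> m`! <= #|copy i|.
Proof.
move=> /copy_neq0[p hp]; pose P : {set 'I_n} := [set l : 'I_n | l < m].
have cP : #|P| = m by rewrite card_lt_ord //; have := ltn_ord z; rewrite hz; lia.
rewrite -cP -card_perm -(card_imset _ (mulIg p)) (copy_block hp).
apply: subset_leq_card; apply/subsetP => q /imsetP[s hs ->].
apply/blockP => l hl; rewrite permM (out_perm hs) //.
by rewrite !inE -leqNgt.
Qed.

(** * Bad copies and the main colour *)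

Definition bad : {set 'I_n} := [set i in syms | 1 < #|cols i|].

Lemma bad_syms : bad \subset syms.
Proof. by apply/subsetP => i; rewrite inE => /andP[]. Qed.

Lemma bad_fc i : i \in bad -> 2 * m - 3 <= fc i.
Proof.
rewrite inE => /andP[hi hb]; apply: leq_trans (IH_copy hi).
have -> : (2 * m - 3)%N = gb m 1 by [].
by apply: gb_mono => //; rewrite -subn1; lia.
Qed.

Lemma sum_bad_le (A : {set 'I_n}) : A \subset syms -> \sum_(i in A) fc i <= #|X :&: F|.
Proof. by move=> hA; rewrite card_F_sum [leqRHS](big_setID A) /= (setIidPr hA) leq_addr. Qed.

(** Four bad copies would already contain [4 * (2 * m - 3) = 8 * m.+1 - 20] vertices of [F]. *)
Lemma bad_le3 : #|X :&: F| < 8 * m.+1 - 20 -> #|bad| <= 3.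
Proof.
move=> h; have := sum_bad_le bad_syms.
have : \sum_(i in bad) (2 * m - 3) <= \sum_(i in bad) fc i by apply: leq_sum => i /bad_fc.
rewrite sum_nat_const => h1 h2; have := leq_trans h1 h2; move: h hm.
move: #|bad| #|_ :&: _|; clear; nia.
Qed.

Lemma cols_mem p : p \in X -> p \notin F -> c p \in cols (p z).
Proof. by move=> hp pF; apply: imset_f; rewrite in_setD pF in_copy hp eqxx. Qed.

(* Otherwise the good copies of the colour of one good copy are separated from
   the copies avoiding this colour, contradicting cut_bound. *)
Lemma main_color : #|X :&: F| < 8 * m.+1 - 20 ->
  exists c0, forall i, i \in syms -> c0 \in cols i.
Proof.
move=> hF; have b3 := bad_le3 hF.
have [i0 hi0 ni0] : exists2 i, i \in syms & i \notin bad.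
  have : 0 < #|syms :\: bad|.
    by rewrite cardsD (setIidPr bad_syms) card_syms; move: b3 hm; clear; lia.
  by case/card_gt0P => i; rewrite in_setD => /andP[]; exists i.
(* A copy has at least [m!] vertices, and [8 * m.+1 - 20 <= m!], so [F] cannot swallow it. *)
have : 0 < #|copy i0 :\: F|.
  rewrite cardsD subn_gt0; apply: leq_ltn_trans (leq_trans hF _).
    by rewrite card_F_sum (bigD1 i0) //= leq_addr.
  apply: leq_trans (card_copy hi0); move: hm fact_big; clear; case: m => // k hk.
  by rewrite factS /=; move: (k`!) => t; nia.
case/card_gt0P => p hp; exists (c p).
have c0 : c p \in cols i0 by apply: imset_f.
have mono i : i \in syms -> i \notin bad -> c p \in cols i -> cols i = [set c p].
  move=> hi; rewrite inE hi /= -leqNgt => h1 hc0; apply/eqP; rewrite eq_sym eqEcard.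
  by rewrite sub1set hc0 cards1.
pose A := [set i in syms | (i \notin bad) && (c p \in cols i)].
pose B := [set i in syms | c p \notin cols i].
case: (set_0Vmem B) => [B0 i hi | [i iB]].
  by apply/negP => /negP h; have := in_set0 i; rewrite -B0 inE hi h.
have out : {subset syms :\: (A :|: B) <= bad}.
  move=> j; rewrite in_setD in_setU => /andP[hn hj]; apply: contraR hn => jb.
  by rewrite in_set [j \in B]in_set hj jb /= orbN.
suff : 8 * m.+1 - 20 <= #|X :&: F| by rewrite leqNgt hF.
apply: (@cut_bound A B).
- by apply/subsetP => j; rewrite inE => /andP[].
- by apply/subsetP => j; rewrite inE => /andP[].
- by rewrite disjoints_subset; apply/subsetP => j; rewrite !in_setC !in_set => /and3P[-> _ ->].
- by apply/card_gt0P; exists i0; rewrite in_set hi0 ni0 c0.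
- by apply/card_gt0P; exists i.
- by apply: leq_trans b3; apply: subset_leq_card; apply/subsetP.
- by move=> j /out/bad_fc.
move=> q qX qF tF.
have E : c q = c (tv false q).
  by apply: hc (tv_nb _ _); rewrite in_setD ?qF ?tF ?qX //= tv_X.
have hq := cols_mem qX qF; have ht := cols_mem (tv_X false qX) tF.
rewrite rot3_idx //= -E in ht.
have AE j : j \in A -> c q \in cols j -> c q = c p.
  by rewrite in_set => /and3P[h1 h2 h3]; rewrite mono // inE => /eqP.
have BE j : j \in B -> c q \in cols j -> c q != c p.
  by rewrite in_set => /andP[_ h1] h2; apply: contraNneq h1 => <-.
by apply/negP => /orP[] /andP[h1 h2];
 [have := BE _ h2 ht; rewrite (AE _ h1 hq) eqxx | have := BE _ h1 hq; rewrite (AE _ h2 ht) eqxx].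
Qed.

(** * Small colours and their triangles *)

Section Small.
Variable c0 : K.
Hypothesis hc0 : forall i, i \in syms -> c0 \in cols i.

Definition small : {set K} := c @: (X :\: F) :\ c0.
Definition smc i : {set K} := cols i :\ c0.
Definition U : {set T} := [set p in X :\: F | c p != c0].
Definition Fo : {set T} := [set p in X :&: F | p z \notin bad].
Definition tri p : {set T} := [set p; tv false p; tv true p].
(** For [p] in [U], whose own copy is bad, this says that the whole triangle lies in bad copies. *)
Definition full p := (p (pos true) \in bad) && (p (pos false) \in bad).
(** For a [p] that is not full, a vertex of its triangle outside the bad copies. *)
Definition phi p : T := if p (pos true) \in bad then tv true p else tv false p.

Lemma tv_z e p : tv e p z = p (pos (~~ e)).
Proof. by rewrite rot3_idx. Qed.

Lemma triP p q : reflect (q = p \/ exists e, q = tv e p) (q \in tri p).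
Proof.
rewrite !inE; apply: (iffP orP) => [[/orP[]/eqP->|/eqP->]|[->|[e ->]]].
- by left.
- by right; exists false.
- by right; exists true.
- by rewrite eqxx; left.
- by case: e; rewrite eqxx ?orbT; auto.
Qed.

Lemma tri_refl p : p \in tri p.
Proof. by apply/triP; left. Qed.

Lemma tri_sym p q : q \in tri p -> p \in tri q.
Proof.
by case/triP => [->|[e ->]]; apply/triP; [left|right; exists (~~ e); rewrite rot3K].
Qed.

Lemma tri_trans p q r : q \in tri p -> r \in tri q -> r \in tri p.
Proof.
case/triP => [-> //|[e ->]] /triP[->|[f ->]]; first by apply/triP; right; exists e.
case: (eqVneq e f) => [->|ef]; first by apply/triP; right; exists (~~ f); rewrite rot3_rot.
have -> : f = ~~ e by case: (e) (f) ef => -[].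
by apply/triP; left; rewrite rot3K.
Qed.

Lemma tri_join p q r : r \in tri p -> r \in tri q -> q \in tri p.
Proof. by move=> hp /tri_sym; apply: tri_trans. Qed.

Lemma tri_X p q : q \in tri p -> p \in X -> q \in X.
Proof. by case/triP => [->//|[e ->]] /tv_X. Qed.

Lemma tri_color p q : q \in tri p -> p \in X -> p \notin F -> q \notin F -> c p = c q.
Proof.
move=> hq pX pF qF; have qX := tri_X hq pX.
case/triP: hq qX qF => [->//|[e ->]] qX qF.
by apply: hc (tv_nb _ _); rewrite in_setD ?pF ?qF.
Qed.

Lemma tri_lab p q : q \in tri p -> q z = p z -> q = p.
Proof.
case/triP => [-> //|[e ->]]; rewrite tv_z => /perm_inj/eqP.
by rewrite pos_neq.
Qed.

Lemma U_X p : p \in U -> p \in X. Proof. by rewrite in_set in_setD => /andP[/andP[]]. Qed.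
Lemma U_F p : p \in U -> p \notin F. Proof. by rewrite in_set in_setD => /andP[/andP[]]. Qed.
Lemma U_c p : p \in U -> c p != c0. Proof. by rewrite in_set => /andP[]. Qed.

Lemma smc_bad i d : i \in syms -> d \in smc i -> i \in bad.
Proof.
move=> hi hd; rewrite inE hi (cardsD1 c0) hc0 // add1n ltnS.
by apply/card_gt0P; exists d.
Qed.

Lemma card_cols i : i \in syms -> #|cols i|.-1 = #|smc i|.
Proof. by move=> hi; rewrite (cardsD1 c0) hc0. Qed.

Lemma bad_smc i : i \in bad -> 0 < #|smc i|.
Proof. by rewrite inE => /andP[hi]; rewrite -card_cols // -subn1 subn_gt0. Qed.

Lemma fc_smc i : i \in bad -> gb m #|smc i| <= fc i.
Proof. by rewrite inE => /andP[hi _]; rewrite -card_cols //; apply: IH_copy. Qed.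

Lemma U_smc p : p \in U -> c p \in smc (p z).
Proof. by move=> hp; rewrite in_setD1 U_c // cols_mem ?U_X ?U_F. Qed.

Lemma lab_syms p : p \in X -> p z \in syms.
Proof. by move=> hp; apply: sym_val => //; rewrite hz. Qed.

Lemma U_bad p : p \in U -> p z \in bad.
Proof. by move=> hp; apply: smc_bad (U_smc hp); apply/lab_syms/U_X. Qed.

Lemma card_small : #|c @: (X :\: F)|.-1 = #|small|.
Proof.
rewrite (cardsD1 c0).
have /imsetP[q] := hc0 (lab_syms (block_refl m.+1 p0)).
rewrite in_setD in_copy => /and3P[qF qX _] cq.
by have -> : c0 \in c @: (X :\: F) by rewrite cq imset_f // in_setD qF.
Qed.

Lemma card_F_bad : #|X :&: F| = \sum_(i in bad) fc i + #|Fo|.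
Proof.
rewrite -(card_F_part bad_syms) -(cardsID [set p : T | p z \in bad] (X :&: F)).
by congr (_ + _); apply: eq_card => p; rewrite !(in_set, in_setI, in_setD) // andbC.
Qed.

Lemma small_rep d : d \in small -> exists2 p, p \in U & c p = d.
Proof.
rewrite in_setD1 => /andP[dc /imsetP[p hp dE]]; exists p => //.
by rewrite in_set hp -dE.
Qed.

Definition rep d : T := odflt p0 [pick p in U | c p == d].

Lemma repP d : d \in small -> rep d \in U /\ c (rep d) = d.
Proof.
move=> /small_rep[p hp hd]; rewrite /rep; case: pickP => [q /andP[hq /eqP qd] //|/(_ p)].
by rewrite hp hd eqxx.
Qed.

Lemma U_small p : p \in U -> c p \in small.
Proof. by move=> hp; rewrite in_setD1 U_c // imset_f // in_setD U_X ?U_F. Qed.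

Lemma small_cover : small \subset \bigcup_(i in bad) smc i.
Proof.
apply/subsetP => d /small_rep[p hp <-]; apply/bigcupP; exists (p z); first exact: U_bad.
exact: U_smc.
Qed.

(** If it survived, [tv e p] would have the small colour of [p], and its copy would then be bad. *)
Lemma tv_Fo e p : p \in U -> p (pos (~~ e)) \notin bad -> tv e p \in Fo.
Proof.
move=> hp hb; have tX := tv_X e (U_X hp).
rewrite in_set in_setI tX tv_z hb andbT /=; apply/negP => /negP tF.
case/negP: hb; rewrite -tv_z; apply: U_bad; rewrite in_set in_setD tX tF.
have ht : tv e p \in tri p by apply/triP; right; exists e.
by rewrite /= -(tri_color ht (U_X hp) (U_F hp) tF) U_c.
Qed.

Lemma phi_tri p : phi p \in tri p.
Proof. by apply/triP; right; rewrite /phi; case: ifP => _; [exists true|exists false]. Qed.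

Lemma phi_Fo p : p \in U -> ~~ full p -> phi p \in Fo.
Proof.
move=> hp; rewrite /full /phi; case: ifP => [_ /= h|/negbT h _].
  by apply: (tv_Fo (e := true)).
by apply: (tv_Fo (e := false)).
Qed.

Lemma lab3 p : [/\ p z != p (pos true), p z != p (pos false) & p (pos true) != p (pos false)].
Proof. by split; rewrite (inj_eq perm_inj) // eq_sym pos_neq. Qed.

Lemma full_card p : p \in U -> full p -> #|[set p z; p (pos true); p (pos false)]| = 3 /\
  [set p z; p (pos true); p (pos false)] \subset bad.
Proof.
move=> hp /andP[h1 h2]; have [d1 d2 d3] := lab3 p; split.
  by rewrite -setUA cardsU1 cards2 !inE negb_or d1 d2 d3.
by rewrite !subUset !sub1set h1 h2 U_bad.
Qed.

Lemma full_bad p : #|bad| <= 3 -> p \in U -> full p ->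
  bad = [set p z; p (pos true); p (pos false)].
Proof.
by move=> b3 hp /(full_card hp)[h1 h2]; apply/eqP; rewrite eq_sym eqEcard h2 h1.
Qed.

Lemma not_full p : #|bad| <= 2 -> p \in U -> ~~ full p.
Proof.
move=> b2 hp; apply/negP => /(full_card hp)[h1 h2].
by have := leq_trans (subset_leq_card h2) b2; rewrite h1.
Qed.

Lemma phi_color p q : p \in U -> q \in U -> phi p = phi q -> c p = c q.
Proof.
move=> hp hq E; apply: tri_color; rewrite ?U_X ?U_F //.
by apply: tri_join (phi_tri p) _; rewrite E phi_tri.
Qed.

Lemma phi_lab p q : phi p = phi q -> p z = q z -> p = q.
Proof.
move=> E h; symmetry; apply: tri_lab; last by rewrite h.
by apply: tri_join (phi_tri p) _; rewrite E phi_tri.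
Qed.

(** The triangle of a representative has two vertices outside the only bad copy, and triangles of
    different colours are disjoint. *)
Lemma Fo_ge2 : #|bad| = 1%N -> 2 * #|small| <= #|Fo|.
Proof.
move=> b1; have -> : (2 * #|small|)%N = #|setX small [set: bool]|.
  by rewrite cardsX cardsT card_bool mulnC.
pose f (w : K * bool) : T := tv w.2 (rep w.1).
rewrite -(card_in_imset (f := f)).
  apply: subset_leq_card; apply/subsetP => q /imsetP[[d e]]; rewrite in_setX => /andP[/= hd _] ->.
  have [hU _] := repP hd; apply: tv_Fo => //; apply/negP => h.
  have := U_bad hU; move: h; have/eqP/cards1P[x ->] := b1.
  rewrite !inE /= => /eqP <-; rewrite (inj_eq perm_inj) eq_sym pos_neq //.
move=> [d e] [d' e']; rewrite !in_setX => /andP[/= hd _] /andP[/= hd' _] E.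
have [hU hcd] := repP hd; have [hU' hcd'] := repP hd'.
have dd : d = d'.
  rewrite -hcd -hcd'; apply: tri_color; rewrite ?U_X ?U_F //.
  have h1 : tv e (rep d) \in tri (rep d) by apply/triP; right; exists e.
  have h2 : tv e (rep d) \in tri (rep d') by apply/triP; right; exists e'; exact: E.
  exact: tri_join h1 h2.
by subst d'; move/rot3_inj: E => /(_ z2 z2) [->].
Qed.

(** A triangle meets three copies, so it leaves two bad ones; [phi] picks such a vertex for one
    representative per colour. *)
Lemma Fo_ge1 : #|bad| <= 2 -> #|small| <= #|Fo|.
Proof.
move=> b2; rewrite -(card_in_imset (f := phi \o rep)).
  apply: subset_leq_card; apply/subsetP => q /imsetP[d hd ->].
  by have [hU _] := repP hd; apply: phi_Fo => //; apply: not_full.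
move=> d d' hd hd' /= E; have [hU <-] := repP hd; have [hU' <-] := repP hd'.
exact: phi_color.
Qed.

Lemma smc_rep i d : i \in bad -> d \in smc i -> exists p, [/\ p \in U, p z = i & c p = d].
Proof.
move=> hi; rewrite in_setD1 => /andP[dc /imsetP[p]].
rewrite in_setD in_copy => /and3P[pF pX /eqP pz] dE; exists p; split=> //.
by rewrite in_set in_setD pF pX -dE.
Qed.

(** The vertex of a full triangle in the bad copy [i]. *)
Definition to_copy i p : T :=
  if p z == i then p else if p (pos true) == i then tv false p else tv true p.

Lemma to_copy_tri i p : to_copy i p \in tri p.
Proof.
rewrite /to_copy; case: ifP => _; first exact: tri_refl.
by case: ifP => _; apply/triP; right; [exists false|exists true].
Qed.

Lemma to_copy_z i p : #|bad| <= 3 -> p \in U -> full p -> i \in bad -> to_copy i p z = i.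
Proof.
move=> b3 hp fp; rewrite (full_bad b3 hp fp) !inE /to_copy.
case: (eqVneq (p z) i) => [//|h1]; case: (eqVneq (p (pos true)) i) => [<- _|h2].
  by rewrite tv_z.
by rewrite tv_z /= => /eqP.
Qed.

(** The bad labels are exactly the symbols of [p] at [z] and at the first two positions, while a
    rotation brings the symbol of another position to the front. *)
Lemma rots_not_full p r : #|bad| <= 3 -> p \in U -> full p -> r \in rots m p -> ~~ full r.
Proof.
move=> b3 hp fp /imsetP[[e k]]; rewrite inE /= => /andP[k2 km] ->.
have : p k \notin bad.
  rewrite (full_bad b3 hp fp) !inE !(inj_eq perm_inj) ![k == pos _]eq_sym !pos_neq //.
  by rewrite !orbF -val_eqE /= hz neq_ltn km.
apply: contra => /andP[h1 h2]; rewrite -(rot3_pos p e k2).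
by case: (e) h1 h2.
Qed.

Lemma nb_neq p : p \notin nb m p.
Proof.
apply/negP => /nbP[/(congr1 (fun q : T => q (pos true)))|[e [i [/andP[h2 _]]]]].
  by rewrite sw_pos => /perm_inj/eqP.
move/(congr1 (fun q : T => q i)); rewrite rot3_idx // => /perm_inj/eqP.
by rewrite eq_sym pos_neq.
Qed.

Lemma U_nb p q : p \in U -> q \in nb m p -> q \notin F -> q \in U /\ c q = c p.
Proof.
move=> hp hq qF.
have qX : q \in X by apply: nb_block (U_X hp) (nbW hq); lia.
have E : c p = c q by apply: hc (nbW hq); rewrite in_setD ?(U_F hp) ?(U_X hp) ?qF ?qX.
by rewrite in_set in_setD qF qX -E U_c.
Qed.

(* In copy u z, each of the 2m - 4 rotations r of u is in F, or else its triangle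
   is not full and meets Fo.  Each other small colour contributes the vertex of
   its triangle in copy u z, or again a vertex of Fo. *)
Lemma full_bound u : #|bad| <= 3 -> u \in U -> full u -> #|smc (u z)| = 1%N ->
  2 * m - 4 + #|small|.-1 <= fc (u z) + #|Fo|.
Proof.
move=> b3 hu fu s1.
have hi : u z \in bad := U_bad hu.
have smE : smc (u z) = [set c u].
  have /eqP/cards1P[d dE] := s1.
  by have := U_smc hu; rewrite dE inE => /eqP ->.
pose G := (copy (u z) :&: F) :|: Fo.
pose al r : T := if r \in F then r else phi r.
pose be d : T := if full (rep d) then to_copy (u z) (rep d) else phi (rep d).
have rC r : r \in rots m u -> r z = u z.
  by move=> hr; apply: nb_z; rewrite in_setU hr orbT.
have rU r : r \in rots m u -> r \notin F -> r \in U /\ c r = c u.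
  by move=> hr; apply: U_nb => //; rewrite in_setU hr orbT.
have rX r : r \in rots m u -> r \in X.
  by move=> hr; apply: nb_block (U_X hu) (nbW (q := r) _); rewrite ?in_setU ?hr ?orbT; lia.
have nf r : r \in rots m u -> ~~ full r by apply: rots_not_full.
have FoB p : p \in Fo -> p z != u z.
  by rewrite in_set => /andP[_]; apply: contraNneq => ->.
have beT d : be d \in tri (rep d).
  by rewrite /be; case: ifP => _; [apply: to_copy_tri|apply: phi_tri].
have alG : al @: rots m u \subset G.
  apply/subsetP => q /imsetP[r hr ->]; rewrite /al in_setU; case: (boolP (r \in F)) => rF.
    by rewrite in_setI in_copy rX // rC // eqxx rF.
  by have [hU _] := rU r hr rF; rewrite phi_Fo ?nf ?orbT.
have beG : be @: (small :\ c u) \subset G.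
  apply/subsetP => q /imsetP[d]; rewrite in_setD1 => /andP[du hd] ->.
  have [hU hcd] := repP hd.
  rewrite /be in_setU; case: ifP => [fd|/negbT fd]; last by rewrite phi_Fo ?orbT.
  have tX := tri_X (to_copy_tri (u z) (rep d)) (U_X hU).
  have tz := to_copy_z b3 hU fd hi.
  rewrite in_setI in_copy tX tz eqxx /=; apply/orP; left; apply/negP => /negP tF.
  have E := tri_color (to_copy_tri (u z) (rep d)) (U_X hU) (U_F hU) tF.
  have : d \in smc (u z).
    by rewrite in_setD1 -{1}hcd U_c // -hcd E -[in cols _]tz cols_mem.
  by rewrite smE inE (negPf du).
have al_inj : {in rots m u &, injective al}.
  move=> r r' hr hr'; rewrite /al; case: ifP => rF; case: ifP => rF' // E.
  - have [hU _] := rU r' hr' (negbT rF').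
    by have := FoB _ (phi_Fo hU (nf _ hr')); rewrite -E rC // eqxx.
  - have [hU _] := rU r hr (negbT rF).
    by have := FoB _ (phi_Fo hU (nf _ hr)); rewrite E rC // eqxx.
  - by apply: phi_lab E _; rewrite !rC.
have be_inj : {in small :\ c u &, injective be}.
  move=> d d' /setD1P[_ hd] /setD1P[_ hd'] E.
  have [hU <-] := repP hd; have [hU' <-] := repP hd'.
  apply: tri_color; rewrite ?U_X ?U_F //.
  by apply: tri_join (beT d) _; rewrite E.
(* If [r] is deleted, a common value is [r] itself: it would lie in a full triangle, or in [Fo]
   although its copy is bad. If [r] survives, it shares a triangle with [rep d], which forces
   [d = c u]. *)
have dis : [disjoint al @: rots m u & be @: (small :\ c u)].
  apply/pred0P => q /=; apply/negP => /andP[/imsetP[r hr qr] /imsetP[d hd qd]].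
  move: hd; rewrite in_setD1 => /andP[du hd]; have [hU hcd] := repP hd.
  have qt := beT d; rewrite -qd qr /al in qt; move: qr; rewrite /al.
  case: (boolP (r \in F)) qt => rF qt qr.
    move: qd; rewrite /be; case: ifP => [fd|/negbT fd] qd.
      case/negP: (nf _ hr).
      have bE := full_bad b3 hU fd.
      have : [/\ r z \in bad, r (pos true) \in bad & r (pos false) \in bad].
        case/triP: qt => [->|[e ->]]; first by rewrite bE !inE !eqxx ?orbT.
        case: e; rewrite (rot3_idx _ _ z2) ?(rot3_pos _ true z2) ?(rot3_posN _ true z2)
          ?(rot3_pos _ false z2) ?(rot3_posN _ false z2) bE !inE !eqxx ?orbT //.
      by case=> _ h1 h2; rewrite /full h1 h2.
    by have := FoB _ (phi_Fo hU fd); rewrite -qd qr rC // eqxx.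
  have [hrU hrc] := rU r hr rF.
  have E : c r = c (rep d).
    by apply: tri_color; rewrite ?U_X ?U_F //; apply: tri_join (phi_tri r) qt.
  by move: du; rewrite -hcd -E hrc eqxx.
have cG : #|G| <= fc (u z) + #|Fo| by apply: leq_card_setU.
apply: leq_trans cG.
have hU2 : al @: rots m u :|: be @: (small :\ c u) \subset G by rewrite subUset alG.
apply: leq_trans (subset_leq_card hU2).
have cm : 2 <= m <= n by have := ltn_ord z; rewrite hz; lia.
rewrite cardsU (disjoint_setI0 dis) cards0 subn0.
rewrite (card_in_imset al_inj) (card_in_imset be_inj) card_rots //.
rewrite [#|small|](cardsD1 (c u)) U_small //; lia.
Qed.

(** * Three bad copies *)

Lemma card3_bound i j k : bad = [set i; j; k] -> i != j -> i != k -> j != k ->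
  #|X :&: F| = fc i + fc j + fc k + #|Fo| /\ #|small| <= #|smc i| + #|smc j| + #|smc k|.
Proof.
move=> bE ij ik jk; have nk : k \notin [set i; j] by rewrite !inE negb_or ![k == _]eq_sym ik jk.
(* Stated for any commutative operation, to serve both the sum of deleted vertices and the union of
   colour sets. *)
have E (R : Type) (idx : R) (op : Monoid.com_law idx) (f : 'I_n -> R) :
    \big[op/idx]_(t in bad) f t = op (op (f i) (f j)) (f k).
  rewrite bE setUC big_setU1 //= big_setU1 ?inE //= big_set1.
  by rewrite Monoid.mulmC.
split; first by rewrite card_F_bad E.
apply: leq_trans (subset_leq_card small_cover) _; rewrite E /=.
by rewrite (leq_trans (leq_card_setU _ _)) // leq_add2r leq_card_setU.
Qed.

(** Here [s] is the number of small colours in the third copy, and the last estimate is the one of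
    [full_bound]; for both [s = 1] and [s = 2] the sum is exactly [gb m.+1 s.+2]. *)
Lemma single_arith (s fi fj fk fo : nat) : 0 < s -> s <= 2 ->
  2 * m - 3 <= fj -> gb m s <= fk -> 2 * m - 4 + s.+2.-1 <= fi + fo ->
  gb m.+1 s.+2 <= fi + fj + fk + fo.
Proof. by move: hm; clear; case: s => [|[|[|s]]] //=; lia. Qed.

(** The splits 1+1+1 and 1+1+2. A full vertex in a copy with one small colour allows [full_bound];
    otherwise the two single colours give two vertices of [Fo]. *)
Lemma two_single_bound i j k : bad = [set i; j; k] -> i != j -> i != k -> j != k ->
  #|smc i| = 1%N -> #|smc j| = 1%N -> #|small| = #|smc k|.+2 -> #|smc k| <= 2 ->
  gb m.+1 #|small| <= #|X :&: F|.
Proof.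
move=> bE ij ik jk si sj s k2.
have [hF _] := card3_bound bE ij ik jk.
have b3 : #|bad| <= 3.
  by rewrite bE; apply: leq_trans (leq_card_setU _ _) _; rewrite cards1 cards2 ij.
have [hi hj hk] : [/\ i \in bad, j \in bad & k \in bad] by rewrite bE !inE !eqxx ?orbT.
have fi := fc_smc hi; have fj := fc_smc hj; have fk := fc_smc hk.
have sk := bad_smc hk.
rewrite si /= in fi; rewrite sj /= in fj.
have /eqP/cards1P[di diE] := si; have /eqP/cards1P[dj djE] := sj.
have [ui [hui uiz uic]] : exists p, [/\ p \in U, p z = i & c p = di].
  by apply: smc_rep => //; rewrite diE inE.
have [uj [huj ujz ujc]] : exists p, [/\ p \in U, p z = j & c p = dj].
  by apply: smc_rep => //; rewrite djE inE.
have dij : di != dj.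
  apply/eqP => E; have : #|small| <= #|[set di] :|: smc k|.
    apply: subset_leq_card; apply/subsetP => d /(subsetP small_cover)/bigcupP[t].
    rewrite bE !in_setU => /orP[/orP[]|] /set1P ->; last by move=> ->; rewrite orbT.
      by rewrite diE => ->.
    by rewrite djE E => ->.
  move=> h; have := leq_trans h (leq_card_setU _ _); rewrite cards1 s add1n ltnn //.
rewrite hF s.
case: (boolP (full ui)) => fui.
  have := full_bound b3 hui fui; rewrite uiz s => /(_ si).
  by move: fj fk; apply: single_arith.
case: (boolP (full uj)) => fuj.
  have := full_bound b3 huj fuj; rewrite ujz s => /(_ sj); rewrite [_ + fc j]addnC.
  by move: fi fk; apply: single_arith.
(* Since [#|smc k| <= 2], two vertices of [Fo] beyond [2 * m - 3 <= fc i] match the estimate of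
   [full_bound]. *)
have o2 : 2 <= #|Fo|.
  have <- : #|[set phi ui; phi uj]| = 2.
    rewrite cards2; case: eqVneq => // /phi_color; rewrite uic ujc => /(_ hui huj) E.
    by rewrite E eqxx in dij.
  by apply: subset_leq_card; rewrite subUset !sub1set !phi_Fo.
apply: (single_arith sk k2 fj fk); move: fi o2 k2 hm.
by move: #|Fo| #|_ :&: _| #|smc k| => x y w; clear => /=; lia.
Qed.

(** * One and three small colours in two bad copies *)

Implicit Types l : 'I_n.

(** Follow the shared symbol: the swap and the rotations [rot3 e k] move it to [pos (~~ e)], while
    [rot3 (~~ e) k] moves it to [k]. Its place in [r] fixes the type of move, and equal moves would
    give [p = q]. *)
Lemma nb_meet e p q r : p != q -> p (pos e) = q (pos e) ->
  r \in nb m p -> r \in nb m q ->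
  [\/ r = sw n' * p /\ exists2 k : 'I_n, 2 <= k < m & r = rot3 e k * q,
      r = sw n' * q /\ exists2 k : 'I_n, 2 <= k < m & r = rot3 e k * p
    | exists i j : 'I_n, [/\ 2 <= i < m, 2 <= j < m, i != j, r = rot3 e i * p & r = rot3 e j * q] ].
Proof.
move=> pq pqe.
have key x : r \in nb m x -> r (pos (~~ e)) = x (pos e) /\
    (r = sw n' * x \/ exists2 k : 'I_n, 2 <= k < m & r = rot3 e k * x) \/
    exists2 k : 'I_n, 2 <= k < m & (r = rot3 (~~ e) k * x /\ r k = x (pos e)).
  case/nbP => [->|[f [k [hk ->]]]].
    by left; rewrite sw_pos negbK; split; [|left].
  have k2 : 2 <= k by case/andP: hk.
  case: (eqVneq f e) => [->|fe].
    by left; rewrite rot3_posN //; split=> //; right; exists k.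
  have -> : f = ~~ e by case: (f) (e) fe => -[].
  by right; exists k => //; rewrite rot3N_idx.
move=> /key hp /key hq.
case: hp => [[r1 hp]|[k hk [rE rk]]]; last first.
  case: hq => [[r1 _]|[l hl [rE' rl]]].
    move: rk; rewrite pqe -r1 => /perm_inj/eqP; rewrite eq_sym pos_neq //.
    by case/andP: hk.
  have kl : k = l by apply: (@perm_inj _ r); rewrite rk rl.
  by move: pq; rewrite rE kl in rE'; rewrite (mulgI _ _ _ rE') eqxx.
case: hq => [[r2 hq]|[k hk [rE rk]]]; last first.
  move: rk; rewrite -pqe -r1 => /perm_inj/eqP; rewrite eq_sym pos_neq //.
  by case/andP: hk.
case: hp hq => [pE|[k hk pE]] [qE|[l hl qE]].
- by move: pq; rewrite pE in qE; rewrite (mulgI _ _ _ qE) eqxx.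
- by constructor 1; split=> //; exists l.
- by constructor 2; split=> //; exists k.
case: (eqVneq k l) => kl; last by constructor 3; exists k, l.
by move: pq; rewrite pE kl in qE; rewrite (mulgI _ _ _ qE) eqxx.
Qed.

(* In the tight 1+3 case, with u the only vertex of small colour in its copy, the
   other three such vertices are neighbours of tv (~~ e) u obtained by moving a
   neighbour of u along its triangle: leaves, or the center.  They share so few
   neighbours that F cannot be tight. *)
Definition leaf e k p : T := tv e (rot3 e k * p).
Definition center e p : T := tv e (sw n' * p).

Section Leaf.
Variables (e : bool) (u : T).
Local Notation L k := (leaf e k u).
Local Notation C := (center e u).
Local Notation a := (pos e).
Local Notation b := (pos (~~ e)).

Lemma ltm_z k : k < m -> (z == k) = false.
Proof. by move=> h; rewrite -val_eqE /= hz gtn_eqF. Qed.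

Lemma leaf_a k : 2 <= k < m -> L k a = u z.
Proof.
by move=> /andP[k2 km]; rewrite /leaf rot3_pos // rot3_out // ltm_z.
Qed.
Lemma leaf_b k : 2 <= k < m -> L k b = u k.
Proof. by move=> /andP[k2 km]; rewrite /leaf rot3_posN // rot3_pos. Qed.
Lemma leaf_k k : 2 <= k < m -> L k k = u b.
Proof.
by move=> /andP[k2 km]; rewrite /leaf rot3_out 1?eq_sym ?ltm_z // rot3_idx.
Qed.
Lemma leaf_z k : 2 <= k < m -> L k z = u a.
Proof. by move=> /andP[k2 km]; rewrite /leaf rot3_idx // rot3_posN. Qed.
Lemma leaf_out k l : 2 <= k < m -> 2 <= l -> l != k -> l != z -> L k l = u l.
Proof. by move=> /andP[k2 km] l2 lk lz; rewrite /leaf !rot3_out. Qed.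
Lemma center_a : C a = u z.
Proof. by rewrite /center rot3_pos // sw_out. Qed.
Lemma center_b : C b = u b.
Proof. by rewrite /center rot3_posN // sw_pos. Qed.
Lemma center_out l : 2 <= l -> l != z -> C l = u l.
Proof. by move=> l2 lz; rewrite /center rot3_out // sw_out. Qed.

Lemma leaf_neq k l : 2 <= k < m -> 2 <= l < m -> k != l -> L k != L l.
Proof.
move=> hk hl; apply: contra_neq => /(congr1 (fun q : T => q b)).
by rewrite !leaf_b // => /perm_inj.
Qed.

Lemma center_leaf k : 2 <= k < m -> C != L k.
Proof.
move=> hk; apply/eqP => /(congr1 (fun q : T => q b)).
rewrite leaf_b // center_b => /perm_inj/eqP; rewrite pos_neq //; by case/andP: hk.
Qed.

Local Notation q0 := (tv (~~ e) u).

Lemma leaf_q0 k : 2 <= k < m -> rot3 e k * L k = q0.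
Proof.
move=> hk; have /andP[k2 km] := hk.
apply: (@eq_perm_at _ e) => [||j j2].
- by rewrite rot3_pos // leaf_k // rot3N_pos.
- by rewrite rot3_posN // leaf_a // rot3_pos.
case: (eqVneq j k) => [->|jk].
  by rewrite rot3_idx // leaf_b // rot3_out // eq_sym ltm_z.
rewrite rot3_out //; case: (eqVneq j z) => [->|jz].
  by rewrite leaf_z // rot3N_idx.
by rewrite leaf_out // rot3_out.
Qed.

Lemma leaf_at k l : 2 <= k < m -> 2 <= l < m -> L k l = if l == k then u b else u l.
Proof.
move=> hk /andP[l2 lm]; case: eqVneq => [->|lk]; first by rewrite leaf_k.
by rewrite leaf_out // eq_sym ltm_z.
Qed.

Lemma u_bF k : 2 <= k < m -> (u b == u k) = false.
Proof. by case/andP => k2 _; rewrite (inj_eq perm_inj) pos_neq. Qed.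

(** Both leaves carry [u z] at [a], so [nb_meet] applies. Its two swap cases fail on comparing
    symbols, and in the third the rotation of [L k] must be at [k], which leads to [q0]. *)
Lemma leaf_meet k l : 2 <= k < m -> 2 <= l < m -> k != l ->
  nb m (L k) :&: nb m (L l) \subset [set q0].
Proof.
have sw_rot (s t x : 'I_n) : 2 <= s < m -> 2 <= t < m -> s != t -> 2 <= x < m ->
    sw n' * L s = rot3 e x * L t -> False.
  move=> hs ht st hx E; have /andP[s2 sm] := hs; have /andP[x2 xm] := hx.
  have h1 := congr1 (fun q : T => q a) E.
  rewrite sw_pos leaf_b // rot3_pos // leaf_at // in h1.
  have xs : x = s.
    move: h1; case: eqP => [_ /eqP|_ /perm_inj ->//]; rewrite eq_sym u_bF //.
  have h2 := congr1 (fun q : T => q s) E.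
  rewrite xs sw_out // leaf_k // rot3_idx // leaf_b // in h2.
  by have := u_bF ht; rewrite h2 eqxx.
move=> hk hl kl; apply/subsetP => r; rewrite in_setI => /andP[rk rl]; rewrite inE.
have ae : L k a = L l a by rewrite !leaf_a.
case: (nb_meet (leaf_neq hk hl kl) ae rk rl) => [[rE [x hx rE']]|[rE [x hx rE']]|].
- by case: (sw_rot k l x) => //; rewrite -rE.
- by case: (sw_rot l k x) => //; rewrite 1?eq_sym // -rE.
move=> [i [j [hi hj ij ri rj]]]; have /andP[i2 im] := hi.
have h := congr1 (fun q : T => q i) rj.
rewrite ri rot3_idx // rot3_out // leaf_b // leaf_at // in h.
have ik : i = k.
  by move: h; case: eqP => [_ /eqP|_ /perm_inj //]; rewrite eq_sym u_bF.
by rewrite ri ik leaf_q0.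
Qed.

Lemma center_meet k : 2 <= k < m ->
  nb m C :&: nb m (L k) \subset [set q0; sw n' * L k].
Proof.
move=> hk; apply/subsetP => r; rewrite in_setI => /andP[rc rk]; rewrite !inE.
have ae : C a = L k a by rewrite center_a leaf_a.
case: (nb_meet (center_leaf hk) ae rc rk) => [[rE [x hx rE']]|[-> _]|].
- have /andP[x2 xm] := hx.
  have h := congr1 (fun q : T => q a) rE'.
  rewrite rE sw_pos center_b rot3_pos // leaf_at // in h.
  move: h; case: eqP => [xk _|_ /eqP]; last by rewrite u_bF.
  by rewrite rE' xk leaf_q0 // eqxx.
- by rewrite eqxx orbT.
move=> [i [j [hi hj ij ri rj]]]; have /andP[i2 im] := hi; have /andP[j2 jm] := hj.
have h := congr1 (fun q : T => q i) rj.
rewrite ri rot3_idx // rot3_out // center_b leaf_at // in h.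
have ik : i = k by move: h; case: eqP => // _ /eqP; rewrite u_bF.
have h' := congr1 (fun q : T => q j) rj.
rewrite ri rot3_out 1?eq_sym // rot3_idx // leaf_b // center_out // in h'.
  by move/perm_inj: h' => jk; rewrite ik jk eqxx in ij.
by rewrite eq_sym ltm_z.
Qed.

(** Three neighbourhoods of size [2 * m - 3], of which the first two share at most one vertex and
    the third meets their union in at most three. *)
Lemma card_three_nb k l w (G : {set T}) : 2 <= k < m -> 2 <= l < m -> k != l ->
  w = C \/ (exists t : 'I_n, [/\ 2 <= t < m, t != k, t != l & w = L t]) ->
  nb m (L k) \subset G -> nb m (L l) \subset G -> nb m w \subset G ->
  6 * m - 13 <= #|G|.
Proof.
move=> hk hl kl hw sk sl sw'.
have mn : 2 <= m <= n by have := ltn_ord z; rewrite hz; lia.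
have c1 : #|nb m (L k) :&: nb m (L l)| <= 1.
  by have := subset_leq_card (leaf_meet hk hl kl); rewrite cards1.
have c2 : #|(nb m (L k) :|: nb m (L l)) :&: nb m w| <= 3.
  have sub : (nb m (L k) :|: nb m (L l)) :&: nb m w
      \subset [set q0; sw n' * L k; sw n' * L l].
    apply/subsetP => r; rewrite in_setI in_setU => /andP[rkl rw].
    case: hw rw => [->|[t [ht tk tl ->]]] rw.
      case/orP: rkl => h.
        have : r \in nb m C :&: nb m (L k) by rewrite in_setI rw h.
        by move/(subsetP (center_meet hk)); rewrite !inE => /orP[->|->]; rewrite ?orbT.
      have : r \in nb m C :&: nb m (L l) by rewrite in_setI rw h.
      by move/(subsetP (center_meet hl)); rewrite !inE => /orP[->|->]; rewrite ?orbT.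
    case/orP: rkl => h.
      have : r \in nb m (L t) :&: nb m (L k) by rewrite in_setI rw h.
      by move/(subsetP (leaf_meet ht hk tk)); rewrite !inE => ->.
    have : r \in nb m (L t) :&: nb m (L l) by rewrite in_setI rw h.
    by move/(subsetP (leaf_meet ht hl tl)); rewrite !inE => ->.
  apply: leq_trans (subset_leq_card sub) _.
  apply: leq_trans (leq_card_setU _ _) _; rewrite cards1 cards2; by case: eqVneq.
have sG : (nb m (L k) :|: nb m (L l)) :|: nb m w \subset G.
  by apply/subUsetP; split => //; apply/subUsetP.
apply: leq_trans (subset_leq_card sG).
have := cardsUI (nb m (L k) :|: nb m (L l)) (nb m w).
have := cardsUI (nb m (L k)) (nb m (L l)); rewrite !card_nb //.
move: c1 c2; move: #|_ :&: _| #|_ :&: _| #|_ :|: _| #|_ :|: _| => x1 x2 x3 x4; lia.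
Qed.

End Leaf.

(** The known estimates add up to [(2 * m - 3) + (6 * m - 14) + 4], one short of the claim. A
    counterexample makes all of them equalities, which determines [F] near the vertices of small
    colour. *)
Lemma one_three_bound i j : bad = [set i; j] -> i != j ->
  #|smc i| = 1%N -> #|smc j| = 3 -> #|small| = 4 -> 8 * m.+1 - 20 <= #|X :&: F|.
Proof.
move=> bE ij si sj s4; rewrite leqNgt; apply/negP => hlt.
have mn : 2 <= m <= n by have := ltn_ord z; rewrite hz; lia.
have [hi hj] : i \in bad /\ j \in bad by rewrite bE !inE !eqxx ?orbT.
have b2 : #|bad| <= 2 by rewrite bE cards2 ij.
have fi := fc_smc hi; have fj := fc_smc hj; rewrite si /= in fi; rewrite sj /= in fj.
have fo := Fo_ge1 b2; rewrite s4 in fo.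
have hF : #|X :&: F| = fc i + fc j + #|Fo|.
  by rewrite card_F_bad bE big_setU1 ?inE //= big_set1.
have [ei ej eo] : [/\ fc i = (2 * m - 3)%N, fc j = (6 * m - 14)%N & #|Fo| = 4].
  move: hlt fi fj fo hm; rewrite hF.
  by move: #|copy i :&: F| #|copy j :&: F| #|Fo| => x y w; clear; split; lia.
have ULab p : p \in U -> p z = i \/ p z = j.
  by move/U_bad; rewrite bE !inE => /orP[]/eqP; auto.
have dis d : d \in smc i -> d \in smc j -> False.
  move=> di dj; have := subset_leq_card small_cover; rewrite s4.
  have -> : \bigcup_(t in bad) smc t = smc j.
    apply/setP => d'; apply/bigcupP/idP => [[t]|h]; last by exists j.
    rewrite bE => /set2P[] -> //; have /eqP/cards1P[d1 d1E] := si.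
    by move: di; rewrite d1E => /set1P <- /set1P ->.
  by rewrite sj.
have phi_inj : {in U &, injective phi}.
  move=> p q hp hq E; have Ec := phi_color hp hq E.
  have := U_smc hp; have := U_smc hq; rewrite Ec.
  case: (ULab _ hp) (ULab _ hq) => hpz [] hqz; rewrite hpz hqz => h1 h2.
  - by apply: phi_lab E _; rewrite hpz.
  - by case: (dis _ h2 h1).
  - by case: (dis _ h1 h2).
  - by apply: phi_lab E _; rewrite hpz.
have phiU : phi @: U \subset Fo.
  by apply/subsetP => q /imsetP[p hp ->]; apply: phi_Fo => //; apply: not_full.
have cU : c @: U = small.
  apply/eqP; rewrite eqEsubset; apply/andP; split; apply/subsetP => d.
    by case/imsetP => p hp ->; apply: U_small.
  by case/small_rep => p hp <-; apply: imset_f.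
(* [phi] injects [U] into [Fo] and all four small colours occur on [U], so each colour has exactly
   one vertex. *)
have U4 : #|U| = 4.
  apply/eqP; rewrite eqn_leq -{1}(card_in_imset phi_inj) -{1}eo (subset_leq_card phiU) /=.
  by rewrite -s4 -cU leq_imset_card.
have c_inj : {in U &, injective c}.
  by apply/imset_injP; rewrite cU s4 U4.
have phiE : phi @: U = Fo.
  by apply/eqP; rewrite eqEcard phiU eo card_in_imset // U4.
have nbF p q : p \in U -> q \in nb m p -> q \in F.
  move=> hp hq; apply/negP => /negP qF; have [hU E] := U_nb hp hq qF.
  by have := nb_neq p; rewrite -{1}(c_inj _ _ hU hp E) hq.
have tv_phi e p : p \in U -> tv e p \in Fo -> tv e p = phi p.
  move=> hp; rewrite -phiE => /imsetP[q hq E].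
  have te : tv e p \in tri p by apply/triP; right; exists e.
  rewrite E; congr phi; symmetry; apply: c_inj => //.
  by apply: tri_color; rewrite ?U_X ?U_F //; apply: tri_join te _; rewrite E phi_tri.
(* Otherwise both other vertices of the triangle would lie in [Fo] and both would equal [phi p]. *)
have inbad p : p \in U -> exists e, p (pos e) \in bad.
  move=> hp; case: (boolP (p (pos false) \in bad)) => h0; first by exists false.
  case: (boolP (p (pos true) \in bad)) => h1; first by exists true.
  have := tv_phi true p hp (tv_Fo (e := true) hp h0).
  rewrite -(tv_phi false p hp (tv_Fo (e := false) hp h1)).
  by move/rot3_inj => /(_ z2 z2).
have other p e : p \in U -> p (pos e) \in bad -> p (pos e) != p z.
  by move=> _ _; rewrite (inj_eq perm_inj) pos_neq.
have /eqP/cards1P[d0 d0E] := si.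
have [u [hu uz _]] : exists p, [/\ p \in U, p z = i & c p = d0].
  by apply: smc_rep => //; rewrite d0E inE.
have [e ue] := inbad u hu.
have uj : u (pos e) = j.
  by have := other u e hu ue; move: ue; rewrite bE uz !inE => /orP[]/eqP-> //; rewrite eqxx.
(* The neighbours of [u] in its copy are deleted, and they already number [2 * m - 3]. *)
have nbE : copy i :&: F = nb m u.
  apply/eqP; rewrite eq_sym eqEcard ei card_nb // leqnn andbT.
  apply/subsetP => q hq; rewrite in_setI (nbF u) // andbT.
  by apply: nb_copy hq; rewrite in_copy U_X // uz eqxx.
(* The triangle of [v] has a vertex [v'] in copy [i]. No small colour is common to both copies, so
   [v'] is deleted and hence a neighbour of [u]; the place of the symbol [j] decides its form. *)
have form v : v \in U -> v z = j -> v = center e u \/ exists2 k : 'I_n, 2 <= k < m & v = leaf e k u.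
  move=> hv vz; have [f vf] := inbad v hv.
  have vi : v (pos f) = i.
    by have := other v f hv vf; move: vf; rewrite bE vz !inE => /orP[]/eqP-> //; rewrite eqxx.
  pose v' := tv (~~ f) v.
  have vE : v = tv f v' by have := rot3K (~~ f) v z2; rewrite negbK => ->.
  have v'z : v' z = i by rewrite /v' rot3N_idx.
  have v'j : v' (pos (~~ f)) = j by rewrite /v' rot3_pos.
  have v'X : v' \in X by apply: tv_X; apply: U_X.
  have v'F : v' \in F.
    apply/negP => /negP h.
    have tE : v' \in tri v by apply/triP; right; exists (~~ f).
    have E := tri_color tE (U_X hv) (U_F hv) h.
    apply: (dis (c v)); last by rewrite -vz U_smc.
    by rewrite in_setD1 U_c // E -v'z cols_mem.
  have : v' \in nb m u by rewrite -nbE in_setI in_copy v'X v'z eqxx.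
  rewrite -uj in v'j.
  case/nbP => [E|[g [k [hk E]]]]; rewrite E in v'j.
    left; rewrite /center -E; rewrite sw_pos negbK in v'j.
    move/perm_inj: v'j => /(congr1 val); rewrite !val_pos => fe.
    by rewrite vE; case: (f) (e) fe => -[].
  have /andP[k2 km] := hk.
  case: (eqVneq f g) => fg.
    rewrite -fg rot3_posN // in v'j; right; exists k => //.
    have fe : f = e by move/perm_inj: v'j => /(congr1 val); rewrite !val_pos; case: (f) (e) => -[].
    by rewrite /leaf vE -/v' E -fg fe.
  have gf : g = ~~ f by case: (f) (g) fg => -[].
  move: v'j; rewrite gf rot3_pos // => /perm_inj/eqP; rewrite eq_sym pos_neq //.
have [d1 [d2 [d3 [[n12 n13 n23] [h1 h2 h3]]]]] : exists d1 d2 d3,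
    [/\ d1 != d2, d1 != d3 & d2 != d3] /\ [/\ d1 \in smc j, d2 \in smc j & d3 \in smc j].
  have [d1 h1] : exists d, d \in smc j by apply/card_gt0P; rewrite sj.
  have : #|smc j :\ d1| == 2 by move: sj; rewrite (cardsD1 d1) h1 add1n => -[->].
  case/cards2P => d2 [d3 [n23 E]].
  have /setD1P[n2 h2] : d2 \in smc j :\ d1 by rewrite E !inE eqxx.
  have /setD1P[n3 h3] : d3 \in smc j :\ d1 by rewrite E !inE eqxx orbT.
  by exists d1, d2, d3; split; split=> //; rewrite eq_sym.
have [v1 [hv1 z1 e1]] := smc_rep hj h1.
have [v2 [hv2 z2' e2]] := smc_rep hj h2.
have [v3 [hv3 z3 e3]] := smc_rep hj h3.
rewrite -e1 -e2 -e3 in n12 n13 n23.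
have nbG v : v \in U -> v z = j -> nb m v \subset copy j :&: F.
  move=> hv vz; apply/subsetP => q hq; rewrite in_setI (nbF v) // andbT.
  by apply: nb_copy hq; rewrite in_copy U_X // vz eqxx.
have neq x y : c x != c y -> x != y by apply: contra_neq => ->.
have g1 := nbG _ hv1 z1; have g2 := nbG _ hv2 z2'; have g3 := nbG _ hv3 z3.
(* The bound [6 * m - 13] exceeds the exact count [6 * m - 14] in copy [j] by one. *)
have fin k l w : 2 <= k < m -> 2 <= l < m -> k != l ->
    w = center e u \/ (exists t : 'I_n, [/\ 2 <= t < m, t != k, t != l & w = leaf e t u]) ->
    nb m (leaf e k u) \subset copy j :&: F -> nb m (leaf e l u) \subset copy j :&: F ->
    nb m w \subset copy j :&: F -> False.
  move=> hk hl kl hw a1 a2 a3; have := card_three_nb hk hl kl hw a1 a2 a3.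
  by rewrite ej; move: hm; clear; lia.
have kneq x y k l : c x != c y -> x = leaf e k u -> y = leaf e l u -> k != l.
  by move=> h Ex Ey; apply: contra_neq h; rewrite Ex Ey => ->.
case: (form _ hv1 z1) (form _ hv2 z2') (form _ hv3 z3) =>
  [E1|[k1 hk1 E1]] [E2|[k2 hk2 E2]] [E3|[k3 hk3 E3]].
- by move: n12; rewrite E1 E2 eqxx.
- by move: n12; rewrite E1 E2 eqxx.
- by move: n13; rewrite E1 E3 eqxx.
- have k23 := kneq _ _ _ _ n23 E2 E3.
  by rewrite E2 in g2; rewrite E3 in g3; apply: (fin _ _ _ hk2 hk3 k23 _ g2 g3 g1); left.
- by move: n23; rewrite E2 E3 eqxx.
- have k13 := kneq _ _ _ _ n13 E1 E3.
  by rewrite E1 in g1; rewrite E3 in g3; apply: (fin _ _ _ hk1 hk3 k13 _ g1 g3 g2); left.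
- have k12 := kneq _ _ _ _ n12 E1 E2.
  by rewrite E1 in g1; rewrite E2 in g2; apply: (fin _ _ _ hk1 hk2 k12 _ g1 g2 g3); left.
have k12 := kneq _ _ _ _ n12 E1 E2; have k13 := kneq _ _ _ _ n13 E1 E3.
have k23 := kneq _ _ _ _ n23 E2 E3.
rewrite E1 in g1; rewrite E2 in g2; apply: (fin _ _ _ hk1 hk2 k12 _ g1 g2 g3).
by right; exists k3; rewrite ![k3 == _]eq_sym.
Qed.

(** * Combining the cases by the number of bad copies *)

Lemma arith1 (s t f o : nat) : s <= t -> gb m t <= f -> 2 * s <= o -> gb m.+1 s <= f + o.
Proof.
move: hm; clear.
by case: s => [|[|[|[|s]]]]; case: t => [|[|[|[|t]]]] //=; lia.
Qed.

Lemma arith2 (s t1 t2 f1 f2 o : nat) : 0 < t1 -> 0 < t2 -> s <= t1 + t2 ->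
  gb m t1 <= f1 -> gb m t2 <= f2 -> s <= o ->
  ~ [/\ t1 = 1%N, t2 = 3 & s = 4] -> ~ [/\ t1 = 3, t2 = 1%N & s = 4] ->
  gb m.+1 s <= f1 + f2 + o.
Proof.
move: hm; clear => hm.
case: t1 => [|[|[|[|t1]]]] //; case: t2 => [|[|[|[|t2]]]] // _ _;
case: s => [|[|[|[|[|s]]]]] /=; rewrite ?addnS ?addn0 ?ltnS ?ltn0 //= => h1 h2 h3 h4 h5 h6;
try (by case: h5); try (by case: h6); clear h5 h6; lia.
Qed.

(** Outside the excluded splits the bounds of the three copies alone already add up to
    [gb m.+1 s]. *)
Lemma arith3 (s t1 t2 t3 f1 f2 f3 o : nat) : 0 < t1 -> 0 < t2 -> 0 < t3 ->
  s <= t1 + t2 + t3 -> gb m t1 <= f1 -> gb m t2 <= f2 -> gb m t3 <= f3 ->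
  ~ [/\ t1 = 1%N, t2 = 1%N, s = t3.+2 & t3 <= 2] ->
  ~ [/\ t1 = 1%N, t3 = 1%N, s = t2.+2 & t2 <= 2] ->
  ~ [/\ t2 = 1%N, t3 = 1%N, s = t1.+2 & t1 <= 2] ->
  gb m.+1 s <= f1 + f2 + f3 + o.
Proof.
move: hm; clear => hm h1 h2 h3 hs g1 g2 g3 e1 e2 e3.
suff : gb m.+1 s <= f1 + f2 + f3 by move/leq_trans; apply; apply: leq_addr.
apply: leq_trans (leq_add (leq_add g1 g2) g3).
move: e1 e2 e3 hs h1 h2 h3; clear g1 g2 g3.
case: t1 => [|[|[|[|t1]]]] //; case: t2 => [|[|[|[|t2]]]] //;
case: t3 => [|[|[|[|t3]]]] // e1 e2 e3 hs _ _ _;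
case: s hs e1 e2 e3 => [|[|[|[|s]]]] /= hs e1 e2 e3; try lia.
all: try (by case: e1); try (by case: e2); try (by case: e3).
all: case: s hs e1 e2 e3 => [|s] hs e1 e2 e3.
all: try (by case: e1); try (by case: e2); try (by case: e3).
all: clear e1 e2 e3; lia.
Qed.

Lemma small_bound : #|X :&: F| < 8 * m.+1 - 20 -> gb m.+1 #|small| <= #|X :&: F|.
Proof.
move=> hlt; have b3 := bad_le3 hlt.
have hcov := subset_leq_card small_cover.
have := b3; rewrite leq_eqVlt ltnS => /orP[/eqP b|].
  have [i hi] : exists i, i \in bad by apply/card_gt0P; rewrite b.
  have : #|bad :\ i| == 2 by move: b; rewrite (cardsD1 i) hi add1n => -[->].
  case/cards2P => j [k [jk E]].
  have /setD1P[ji hj] : j \in bad :\ i by rewrite E !inE eqxx.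
  have /setD1P[ki hk] : k \in bad :\ i by rewrite E !inE eqxx orbT.
  have bE : bad = [set i; j; k] by rewrite -setUA -E setD1K.
  have ij : i != j by rewrite eq_sym.
  have ik : i != k by rewrite eq_sym.
  have [hF hs] := card3_bound bE ij ik jk.
  have := @arith3 _ _ _ _ _ _ _ #|Fo| (bad_smc hi) (bad_smc hj) (bad_smc hk) hs
    (fc_smc hi) (fc_smc hj) (fc_smc hk); rewrite -hF => h.
  case: (boolP [&& #|smc i| == 1, #|smc j| == 1, #|small| == #|smc k|.+2 & #|smc k| <= 2]%N).
    by case/and4P => /eqP h1 /eqP h2 /eqP h3 h4; apply: (two_single_bound bE).
  move=> n1.
  case: (boolP [&& #|smc i| == 1, #|smc k| == 1, #|small| == #|smc j|.+2 & #|smc j| <= 2]%N).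
    case/and4P => /eqP h1 /eqP h2 /eqP h3 h4; apply: (@two_single_bound i k j) => //.
      by rewrite bE setUAC.
    by rewrite eq_sym.
  move=> n2.
  case: (boolP [&& #|smc j| == 1, #|smc k| == 1, #|small| == #|smc i|.+2 & #|smc i| <= 2]%N).
    case/and4P => /eqP h1 /eqP h2 /eqP h3 h4; apply: (@two_single_bound j k i) => //.
    by rewrite bE -setUA setUC.
  move=> n3; apply: h.
  - by case=> a1 a2 a3 a4; move: n1; rewrite a1 a2 a3 a4 !eqxx.
  - by case=> a1 a2 a3 a4; move: n2; rewrite a1 a2 a3 a4 !eqxx.
  - by case=> a1 a2 a3 a4; move: n3; rewrite a1 a2 a3 a4 !eqxx.
rewrite leq_eqVlt ltnS => /orP[b|].
  have b2 : #|bad| <= 2 by rewrite (eqP b).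
  case/cards2P: b => i [j [ij bE]].
  have [hi hj] : i \in bad /\ j \in bad by rewrite bE !inE !eqxx ?orbT.
  have hs : #|small| <= #|smc i| + #|smc j|.
    apply: leq_trans hcov _; rewrite bE big_setU1 ?inE //= big_set1; exact: leq_card_setU.
  have hF : #|X :&: F| = fc i + fc j + #|Fo|.
    by rewrite card_F_bad bE big_setU1 ?inE //= big_set1.
  rewrite [leqRHS]hF; apply: (arith2 _ _ hs (fc_smc hi) (fc_smc hj) (Fo_ge1 b2)).
  - exact: bad_smc.
  - exact: bad_smc.
  - case=> h1 h2 h3; have := one_three_bound bE ij h1 h2 h3.
    by rewrite leqNgt hlt.
  - case=> h1 h2 h3; rewrite setUC in bE; rewrite eq_sym in ij.
    have := one_three_bound bE ij h2 h1 h3.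
    by rewrite leqNgt hlt.
rewrite leq_eqVlt ltnS leqn0 => /orP[/eqP b|/eqP b].
  (* One bad copy: the bound is met exactly, as [gb m.+1 s = gb m s + 2 * s] for [s <= 4]. *)
  have o2 := Fo_ge2 b.
  have /eqP/cards1P[i bE] := b.
  have hi : i \in bad by rewrite bE inE.
  have hs : #|small| <= #|smc i| by apply: leq_trans hcov _; rewrite bE big_set1.
  have hF : #|X :&: F| = fc i + #|Fo| by rewrite card_F_bad bE big_set1.
  by rewrite [leqRHS]hF; apply: arith1 hs (fc_smc hi) o2.
move/eqP: b; rewrite cards_eq0 => /eqP b.
have : #|small| <= 0 by apply: leq_trans hcov _; rewrite b big_set0 cards0.
by rewrite leqn0 => /eqP ->.
Qed.

End Small.

Lemma gb_max s : gb m.+1 s <= 8 * m.+1 - 20.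
Proof. by move: hm; clear; case: s => [|[|[|[|s]]]] //=; lia. Qed.

Lemma copies_bound : gb m.+1 #|c @: (X :\: F)|.-1 <= #|X :&: F|.
Proof.
case: (leqP (8 * m.+1 - 20) #|X :&: F|) => [|hlt]; first exact: leq_trans (gb_max _).
have [c0 hc0] := main_color hlt.
by rewrite (card_small hc0); apply: small_bound.
Qed.

End Step.

(** The ambient [n] stays fixed while [m] grows: each copy inside a block is again a block of the
    preceding size, so the induction hypothesis applies to it directly. *)
Lemma block_bound n' (K : finType) m (p0 : {perm 'I_n'.+4}) F (c : {perm 'I_n'.+4} -> K) :
  4 <= m <= n'.+4 -> compat m (block m p0) F c ->
  gb m #|c @: (block m p0 :\: F)|.-1 <= #|block m p0 :&: F|.
Proof.
elim: m p0 F c => // m IHm p0 F c /andP[hm mn] hc.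
move: hm; rewrite leq_eqVlt => /orP[/eqP[E]|hm].
  by rewrite -E in hc *; apply: base4.
apply: (@copies_bound n' K m (Ordinal mn)) => // p G d hd.
by apply: IHm => //; rewrite -ltnS hm ltnW.
Qed.

(** * Component connectivity *)

Section BigMin.
Variables (I : eqType) (x0 : nat) (P : pred I) (f : I -> nat).

Lemma bigminn_le (r : seq I) i : i \in r -> P i -> \big[minn/x0]_(j <- r | P j) f j <= f i.
Proof.
elim: r => // j r IH; rewrite inE big_cons => /orP[/eqP<- ->|/IH h /h]; first exact: geq_minl.
by case: ifP => // _; apply: leq_trans; apply: geq_minr.
Qed.

Lemma leq_bigminn (r : seq I) v : v <= x0 -> (forall i, P i -> v <= f i) ->
  v <= \big[minn/x0]_(j <- r | P j) f j.
Proof.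
by move=> hv hf; elim/big_rec: _ => // i x /hf hi hx; rewrite leq_min hi.
Qed.
End BigMin.

(** * Components and colourings *)

Section Components.
Variables (T : finType) (e : rel T) (F : {set T}).
Hypothesis esym : symmetric e.

Lemma del_rel_connect_sym : connect_sym (del_rel e F).
Proof. by apply: sym_connect_sym => x y; rewrite /del_rel esym andbCA. Qed.

Lemma ncomp_del_colors (K : finType) (c : T -> K) :
  (forall x y, x \notin F -> y \notin F -> e x y -> c x = c y) ->
  #|c @: ~: F| <= ncomp_del e F.
Proof.
move=> hc; set r := del_rel e F.
have hcon x y : connect r x y -> c x = c y.
  case/connectP => s; elim: s x => [|u s IH] x /=; first by move=> _ ->.
  by case/andP => /and3P[xF uF xu] /IH h /h <-; apply: hc.
have hF x y : connect r x y -> x \notin F -> y \notin F.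
  case/connectP => s; elim: s x => [|u s IH] x /=; first by move=> _ ->.
  by case/andP => /and3P[xF uF xu] /IH h /h /(_ uF).
apply: leq_trans (leq_imset_card c [predI roots r & ~: F]).
apply: subset_leq_card; apply/subsetP => d /imsetP[x xF ->].
rewrite (hcon _ _ (connect_root r x)); apply: imset_f.
rewrite inE /=; apply/andP; split; first exact: (roots_root del_rel_connect_sym).
by rewrite inE (hF x) ?connect_root // -in_setC.
Qed.

(** The root of a component serves as its colour, which turns a number of components into a number
    of colours. *)
Lemma ncomp_del_root :
  (forall x y, x \notin F -> y \notin F -> e x y -> root (del_rel e F) x = root (del_rel e F) y) /\
  ncomp_del e F <= #|root (del_rel e F) @: ~: F|.
Proof.
split=> [x y xF yF xy|].
  apply/eqP; rewrite root_connect; last exact: del_rel_connect_sym.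
  by apply: connect1; rewrite /del_rel xF yF.
apply: subset_leq_card; apply/subsetP => x; rewrite inE => /andP[/eqP xr xF].
by rewrite -xr imset_f.
Qed.
End Components.

(** * Words, permutations and the lower bound *)

Section Kappa.
Local Open Scope group_scope.
Variable n' : nat.
Local Notation n := n'.+4.
Local Notation T := {perm 'I_n}.
Implicit Types (p q : T).

Lemma size_word p : size (word p) = n.
Proof. by rewrite size_map size_enum_ord. Qed.

Lemma nth_word p (i : 'I_n) : nth 0 (word p) i = p i.
Proof. by rewrite (nth_map i) ?size_enum_ord // nth_ord_enum. Qed.

Lemma word_inj : injective (@word n).
Proof.
move=> p q h; apply/permP => i; apply: val_inj.
by rewrite /= -!nth_word h.
Qed.

Lemma word_sw p : word (sw n' * p) = g12 (word p).
Proof.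
apply: (@eq_from_nth _ 0); first by rewrite /g12 !size_set_nth !size_word.
move=> k; rewrite size_word => kn; rewrite -[k]/(val (Ordinal kn)) nth_word.
case: (leqP 2 k) => hk.
  rewrite sw_out // -nth_word /g12; do !rewrite nth_set_nth /=.
  by case: k kn hk => [|[|k]].
have [e ->] := @posP n' (Ordinal kn) hk.
rewrite sw_pos -nth_word /g12.
by case: e; do !rewrite nth_set_nth /=.
Qed.

Lemma word_rot3 e (i : 'I_n) p : 2 <= i ->
  word (rot3 e i * p) = (if e then gminus i (word p) else gplus i (word p)).
Proof.
move=> hi; apply: (@eq_from_nth _ 0).
  rewrite size_word; case: (e); rewrite /gplus /gminus !size_set_nth size_word.
    by have := ltn_ord i; lia.
  by have := ltn_ord i; lia.
have i0 : (0 == i :> nat) = false by case: (nat_of_ord i) hi.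
have i1 : (1%N == i :> nat) = false by case: (nat_of_ord i) hi => [|[|?]].
move=> k; rewrite size_word => kn; rewrite -[k]/(val (Ordinal kn)) nth_word.
case: (leqP 2 k) => hk.
  case: (eqVneq (Ordinal kn) i) => [->|ki].
    rewrite rot3_idx // -nth_word; case: (e); rewrite /gplus /gminus nth_set_nth /= eqxx //.
  have ki' : (k == i :> nat) = false by apply/negbTE.
  have k0 : (k == 0 :> nat) = false by case: (k) hk.
  have k1 : (k == 1%N :> nat) = false by case: (k) hk => [|[|?]].
  rewrite rot3_out // -nth_word /gplus /gminus.
  by case: (e); do !rewrite nth_set_nth /= ?ki' ?k0 ?k1.
have [f ->] := @posP n' (Ordinal kn) hk.
case: (eqVneq f e) => [->|fe].
  rewrite rot3_pos // -nth_word /gplus /gminus.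
  by case: (e); do !rewrite nth_set_nth /= ?i0 ?i1.
have -> : f = ~~ e by case: (f) (e) fe => -[].
rewrite rot3_posN // -nth_word /gplus /gminus.
by case: (e); do !rewrite nth_set_nth /= ?i0 ?i1.
Qed.

Lemma adj_nb p q : splitstar_adj p q = (q \in nb n p).
Proof.
apply/idP/nbP => [/orP[/eqP|/existsP[i /andP[hi /orP[]/eqP]]]|].
- by rewrite -word_sw => /word_inj; left.
- rewrite -(@word_rot3 false) // => /word_inj ->; right.
  by exists false, i; rewrite hi ltn_ord.
- rewrite -(@word_rot3 true) // => /word_inj ->; right.
  by exists true, i; rewrite hi ltn_ord.
case=> [->|[e [i [/andP[hi _] ->]]]]; apply/orP; first by left; rewrite word_sw.
right; apply/existsP; exists i; rewrite hi word_rot3 //=.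
by case: e; rewrite eqxx ?orbT.
Qed.

Lemma nb_sym m p q : q \in nb m p -> p \in nb m q.
Proof.
case/nbP => [->|[e [i [/andP[hi im] ->]]]]; apply/nbP; [left|right].
  by rewrite mulgA tperm2 mul1g.
by exists (~~ e), i; rewrite hi im rot3K.
Qed.

Lemma adj_sym : symmetric (@splitstar_adj n).
Proof. by move=> p q; rewrite !adj_nb; apply/idP/idP => /nb_sym. Qed.

Lemma block_full p : block n p = setT.
Proof. by apply/setP => q; rewrite in_setT; apply/blockP => i; rewrite leqNgt ltn_ord. Qed.

Lemma card_vertices : #|{perm 'I_n}| = n`!.
Proof. by rewrite -[RHS]card_Sn. Qed.

(** Ensures that cuts leaving at most four vertices are too large to matter, and that the cuts of
    the upper bound leave a vertex besides the isolated ones. *)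
Lemma vertices_ge : 8 * n - 15 <= n`!.
Proof.
elim: n' => // k IH; rewrite factS; move: IH; move: (k.+4)`! => t; nia.
Qed.

Lemma lcut_ge l (F : {set T}) : 0 < l <= 5 -> lcut (@splitstar_adj n) l F -> gb n l.-1 <= #|F|.
Proof.
move=> hl /orP[h|h].
  have [hc hr] := ncomp_del_root F adj_sym.
  have hcomp : compat n (block n (1 : T)) F (root (del_rel (@splitstar_adj n) F)).
    move=> x y; rewrite !in_setD => /andP[xF _] /andP[yF _] xy.
    by apply: hc => //; rewrite adj_nb.
  have := @block_bound n' _ n 1 F _ (leqnn _) hcomp.
  rewrite block_full setTD setTI; apply: leq_trans; apply: gb_mono => //.
  by rewrite -!subn1 leq_sub2r // (leq_trans h).
have := cardsC F; rewrite card_vertices; have := vertices_ge.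
have : gb n l.-1 <= 8 * n - 20.
  by case: l hl {h} => [|[|[|[|[|[|l]]]]]] //= _; lia.
case/andP: hl => _ hl; move: h hl.
by move: (gb _ _) (n`!) #|F| #|~: F| => x y v w; lia.
Qed.

(** * Cuts attaining the bounds *)

Section Upper.
Variable ws : seq (seq nat).
Hypotheses (uws : uniq ws) (gws : all (fun w => w \in words4) ws) (s4 : size ws <= 4).
Let iw := undup (flatten (map nbw ws)).
Hypothesis indep : all (fun w => w \notin iw) ws.
Hypothesis s12 : size iw <= 12.

Let I : seq T := map (@pw n') ws.
Let Fin : {set T} := [set q in map (@pw n') iw].
(** The neighbours of [I] through positions from 4 on; together with [Fin], the neighbours inside
    the block of the identity, they isolate every vertex of [I]. *)
Let Fout : {set T} :=
  [set rot3 x.1.1 x.1.2 * x.2 | x in setX (setX [set: bool] [set i : 'I_n | 4 <= i]) [set q in I]].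
Let F0 := Fin :|: Fout.

Lemma nb_I_F0 p q : p \in I -> q \in nb n p -> q \in F0.
Proof.
case/mapP => w hw ->; have gw := allP gws _ hw => hq.
have inner : q \in nb 4 (pw n' w * 1) -> q \in F0.
  case/(nb_pw gw) => w' hw' ->; rewrite mulg1 in_setU inE map_f //.
  by rewrite mem_undup; apply/flattenP; exists (nbw w) => //; apply: map_f.
case/nbP: hq => [E|[e [i [/andP[i2 _] E]]]].
  by apply: inner; rewrite mulg1 E; apply/nbP; left.
case: (ltnP i 4) => hi.
  by apply: inner; rewrite mulg1 E; apply/nbP; right; exists e, i; rewrite i2.
rewrite in_setU; apply/orP; right; rewrite E; apply/imsetP.
by exists (e, i, pw n' w); rewrite // !inE /= hi map_f.
Qed.

Lemma good_iw w : w \in iw -> good w.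
Proof.
rewrite mem_undup => /flattenP[s /mapP[w' hw' ->]] hw.
by have := allP good_nbw _ (allP gws _ hw') => /allP/(_ _ hw).
Qed.

(** Inside the block this is the independence of [ws]; a vertex of [Fout] has a symbol below 4 at a
    position from 4 on, which no vertex of [I] has. *)
Lemma I_F0 p : p \in I -> p \notin F0.
Proof.
case/mapP => w hw ->; have gw : good w by rewrite -mem_words4 (allP gws).
rewrite in_setU negb_or; apply/andP; split.
  rewrite inE; apply/mapP => -[w' hw' /(pw_inj gw (good_iw hw')) E].
  by have := allP indep _ hw; rewrite E hw'.
apply/imsetP => -[[[e i] q]]; rewrite !inE /= => /andP[hi /mapP[w' hw' ->]].
move/(congr1 (fun q : T => q i)); rewrite rot3_idx; last by apply: leq_trans hi.
have gw' : good w' by rewrite -mem_words4 (allP gws).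
move/(congr1 val); rewrite !pw_val // ltnNge hi /= => E.
have := good_lt gw' (leq_trans (pos_lt2 n' (~~ e)) (isT : 2 <= 4)).
move: E; case: ifP => [_ <-|]; first by rewrite ltnNge hi.
by rewrite (leq_trans (pos_lt2 n' (~~ e))).
Qed.

Lemma card_F0 : #|F0| <= size iw + 2 * (n - 4) * size ws.
Proof.
apply: leq_trans (leq_card_setU _ _) _; apply: leq_add.
  by rewrite cardsE; apply: leq_trans (card_size _) _; rewrite size_map.
apply: leq_trans (leq_imset_card _ _) _; rewrite !cardsX cardsT card_bool.
apply: leq_mul; last by rewrite cardsE; apply: leq_trans (card_size _) _; rewrite size_map.
apply: leq_mul => //.
have -> : [set i : 'I_n | 4 <= i] = ~: [set i : 'I_n | i < 4].
  by apply/setP => i; rewrite !inE -leqNgt.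
by have := cardsC [set i : 'I_n | i < 4]; rewrite card_lt_ord // card_ord; lia.
Qed.

Lemma lcut_F0 : lcut (@splitstar_adj n) (size ws).+1 F0.
Proof.
apply/orP; left.
have uI : uniq I.
  rewrite map_inj_in_uniq // => w w' hw hw'; apply: pw_inj; rewrite -mem_words4 (allP gws) //.
have sI : size I = size ws by rewrite size_map.
(* The two sets have at most [12 + 8 * (n - 4) + 4 = 8 * n - 16] elements, fewer than [n!]. *)
have [y0 y0P] : exists y, y \notin F0 :|: [set q in I].
  apply/existsP; rewrite -negb_forall; apply/negP => /forallP h.
  have {}h : #|F0 :|: [set q in I]| = n`!.
    by rewrite -card_vertices -cardsT; congr #|pred_of_set _|; apply/setP => y; rewrite in_setT h.
  have cF : #|F0| <= 12 + 2 * n' * 4.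
    apply: leq_trans card_F0 _; apply: leq_add => //; apply: leq_mul => //; lia.
  have cI : #|[set q in I]| <= 4 by apply: leq_trans s4; rewrite cardsE -sI card_size.
  have := leq_trans (leq_card_setU F0 [set q in I]) (leq_add cF cI).
  by rewrite h; apply/negP; rewrite -ltnNge; apply: leq_trans (vertices_ge); lia.
rewrite in_setU negb_or in y0P; case/andP: y0P => yF; rewrite inE => yI.
(* Each vertex of [I] is a colour of its own and the rest shares the colour [y0], which gives
   [size ws + 1] colours. *)
pose c x : T := if x \in I then x else y0.
apply: leq_trans (@ncomp_del_colors _ _ F0 adj_sym _ c _).
  have <- : #|[set q in y0 :: I]| = (size ws).+1.
    have uyI : uniq (y0 :: I) by rewrite /= yI.
    by rewrite cardsE (card_uniqP uyI) /= sI.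
  apply: subset_leq_card; apply/subsetP => q; rewrite inE in_cons => /orP[/eqP->|qI].
    by apply/imsetP; exists y0; rewrite ?in_setC // /c (negPf yI).
  by apply/imsetP; exists q; rewrite ?in_setC ?I_F0 // /c qI.
move=> x y xF yF'; rewrite adj_nb => xy; rewrite /c.
case: ifP => [xI|_]; first by have := nb_I_F0 xI xy; rewrite (negPf yF').
by case: ifP => [yI'|//]; have := nb_I_F0 yI' (nb_sym xy); rewrite (negPf xF).
Qed.

Lemma kappa_le : kappa_l (@splitstar_adj n) (size ws).+1 <= size iw + 2 * (n - 4) * size ws.
Proof.
apply: leq_trans card_F0; apply: bigminn_le lcut_F0.
by rewrite mem_index_enum.
Qed.
End Upper.

Lemma kappa_ge l : 0 < l <= 5 -> gb n l.-1 <= kappa_l (@splitstar_adj n) l.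
Proof.
move=> hl; apply: leq_bigminn => [|F]; last exact: lcut_ge.
rewrite card_vertices; apply: leq_trans vertices_ge.
by case: l hl => [|[|[|[|[|[|l]]]]]] //= _; lia.
Qed.

End Kappa.

Theorem theorem2 (n : nat) (hn : 4 <= n) :
  [/\ kappa_l (@splitstar_adj n) 3 = 4 * n - 8,
      kappa_l (@splitstar_adj n) 4 = 6 * n - 14
    & kappa_l (@splitstar_adj n) 5 = 8 * n - 20].
Proof.
case: n hn => [|[|[|[|n]]]] // _.
(* Independent words of length four whose joint neighbourhoods in the 24-vertex split-star have 8,
   10 and 12 elements; these sizes and the side conditions are checked by computation. *)
have h3 : kappa_l (@splitstar_adj n.+4) 3 <= 8 + 2 * (n.+4 - 4) * 2 :=
  @kappa_le n [:: [:: 0; 1; 2; 3]; [:: 0; 2; 1; 3]] isT isT isT isT isT.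
have h4 : kappa_l (@splitstar_adj n.+4) 4 <= 10 + 2 * (n.+4 - 4) * 3 :=
  @kappa_le n [:: [:: 0; 1; 2; 3]; [:: 0; 2; 1; 3]; [:: 3; 1; 2; 0]] isT isT isT isT isT.
have h5 : kappa_l (@splitstar_adj n.+4) 5 <= 12 + 2 * (n.+4 - 4) * 4 :=
  @kappa_le n [:: [:: 0; 1; 2; 3]; [:: 0; 2; 1; 3]; [:: 1; 3; 0; 2]; [:: 2; 3; 0; 1]]
    isT isT isT isT isT.
have := @kappa_ge n 3 isT; have := @kappa_ge n 4 isT; have := @kappa_ge n 5 isT.
rewrite /gb /=; move: h3 h4 h5.
by move: (kappa_l _ 3) (kappa_l _ 4) (kappa_l _ 5) => k3 k4 k5; split; lia.
Qed.
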